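(* Let $d\ge3$, let $S=(S_n)_{n\ge0}$ be the simple random walk on $\mathbb{Z}^d$ starting from the origin, and let $\|\cdot\|$ be either the max norm $\|x\|=\max_{i=1,\dots,d}|x^i|$ or the $\ell^1$-norm $\|x\|=\sum_{i=1}^d|x^i|$ on $\mathbb{R}^d$. Let $N(k)=\sharp\{x\in\mathbb{Z}^d:\|x\|=k\}$ for $k\in\mathbb{Z}_{\ge0}$. Then, for any non-negative function $f$ on $\mathbb{Z}_{\ge0}$, the following conditions are equivalent: (I) $P\left(\sum_{n=1}^\infty f(\|S_n\|)<\infty\right)>0$; (II) $P\left(\sum_{n=1}^\infty f(\|S_n\|)<\infty\right)=1$; (III) $E\left[\sum_{n=1}^\infty f(\|S_n\|)\right]<\infty$; (IV) $\sum_{k=1}^\infty k^{2-d}N(k)f(k)<\infty$; (V) $\sum_{k=1}^\infty kf(k)<\infty$.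
   Context: The simple random walk on $\mathbb{Z}^d$ has i.i.d. increments uniformly distributed on the $2d$ vectors $\pm e_1,\dots,\pm e_d$, where $e_i$ are the standard basis vectors. For $x\in\mathbb{R}^d$, $x^1,\dots,x^d$ denote its coordinates. $\sharp A$ denotes the number of elements of $A$. *)

(* Defs.v *)
From HB Require Import structures.
From mathcomp Require Import all_boot all_order all_algebra finmap.
From mathcomp Require Import all_classical all_reals all_analysis.

Set Implicit Arguments.
Unset Strict Implicit.
Unset Printing Implicit Defensive.

Import Order.TTheory GRing.Theory Num.Theory.
Import numFieldNormedType.Exports.

Local Open Scope classical_set_scope.
Local Open Scope ring_scope.

(* Z^d is 'rV[int]_d with the discrete sigma-algebra; measurableType requires
   a pointed carrier, hence the instance on int. *)
Definition lattice_display : measure_display. Proof. exact. Qed.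

HB.instance Definition _ := isPointed.Build int 0.

HB.instance Definition _ (d : nat) :=
  @isMeasurable.Build lattice_display 'rV[int]_d (@discrete_measurable _)
    (@discrete_measurable0 _) (@discrete_measurableC _)
    (@discrete_measurableU _).

(* Both norms are integer-valued on Z^d, so they are taken with values in nat
   and f (nrm x) makes sense for f : nat -> R; max_normE and l1_normE relate
   them to the corresponding norms on R^d. *)
Definition max_norm (d : nat) (x : 'rV[int]_d) : nat :=
  (\max_(i < d) `|x ord0 i|)%N.

Definition l1_norm (d : nat) (x : 'rV[int]_d) : nat :=
  (\sum_(i < d) `|x ord0 i|)%N.

Lemma max_normE (R : realType) (d : nat) (x : 'rV[int]_d) :
  (max_norm x)%:R = `|map_mx intr x : 'rV[R]_d|.
Proof.
rewrite [RHS]/Num.Def.normr/= mx_normrE.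
rewrite (reindex (fun i : 'I_d => (ord0, i))) /=; last first.
  by exists snd => // -[i j] _; rewrite (ord1 i).
rewrite (big_morph (fun n : nat => n%:R : R) (@natr_max R) (erefl (0%N%:R : R))).
by apply: eq_bigr => i _; rewrite mxE natr_absz intr_norm.
Qed.

Lemma l1_normE (R : realType) (d : nat) (x : 'rV[int]_d) :
  (l1_norm x)%:R = \sum_(i < d) `|(map_mx intr x : 'rV[R]_d) ord0 i|.
Proof.
rewrite natr_sum; apply: eq_bigr => i _.
by rewrite mxE natr_absz intr_norm.
Qed.

(* #|` fset_set A| is the cardinality of A only when A is finite, which
   finite_sphere establishes for both norms. *)
Definition sphere_card (d : nat) (nrm : 'rV[int]_d -> nat) (k : nat) : nat :=
  #|` fset_set [set x : 'rV[int]_d | nrm x = k]|%fset.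

Lemma finite_sphere (d : nat) (nrm : 'rV[int]_d -> nat) (k : nat) :
  nrm = @max_norm d \/ nrm = @l1_norm d ->
  finite_set [set x : 'rV[int]_d | nrm x = k].
Proof.
move=> nrmE.
pose g (y : {ffun 'I_d -> 'I_k.+1 * bool}) : 'rV[int]_d :=
  \row_i ((-1) ^+ (y i).2 * (y i).1%:Z).
apply: (@sub_finite_set _ _ (g @` setT)); last first.
  exact/finite_image/finite_finset.
move=> x /= xk.
have xi (i : 'I_d) : (`|x ord0 i| < k.+1)%N.
  rewrite ltnS -xk; case: nrmE => ->.
    by rewrite /max_norm (bigD1 i) //= leq_maxl.
  by rewrite /l1_norm (bigD1 i) //= leq_addr.
exists [ffun i => (Ordinal (xi i), x ord0 i < 0)] => //.
apply/rowP => i; rewrite mxE ffunE /=.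
by rewrite [RHS]intEsign.
Qed.

Definition unit_steps (d : nat) : set 'rV[int]_d :=
  [set v | exists i : 'I_d, v = delta_mx ord0 i \/ v = - delta_mx ord0 i].

Section random_walk.
Context {dT : measure_display} {T : measurableType dT} {R : realType}.
Variable P : probability T R.

Definition mutually_independent (dE : measure_display) (E : measurableType dE)
    (X : nat -> T -> E) : Prop :=
  forall (J : {fset nat}) (A : nat -> set E),
    (forall j, j \in J -> measurable (A j)) ->
    P (\bigcap_(j in [set` J]) (X j @^-1` A j)) =
    (\prod_(j <- J) P (X j @^-1` A j))%E.

Record simple_random_walk (d : nat) (S : nat -> {RV P >-> 'rV[int]_d}) : Prop :=
  SimpleRandomWalk {
    srw_start : forall t, S 0%N t = 0;
    srw_independent : mutually_independent (fun n t => S n.+1 t - S n t);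
    srw_uniform : forall n v,
      P [set t | S n.+1 t - S n t = v] = (\1_(@unit_steps d) v / (2 * d)%:R)%:E
  }.

End random_walk.

(* Main.v *)
Require Import Defs.
From mathcomp Require Import all_boot all_order all_algebra finmap.
From mathcomp Require Import all_classical all_reals all_analysis measurable_realfun.
From mathcomp Require Import zify ring lra.

Set Implicit Arguments.
Unset Strict Implicit.
Unset Printing Implicit Defensive.

Import Order.TTheory GRing.Theory Num.Theory.

Local Open Scope classical_set_scope.
Local Open Scope ring_scope.

(** Write m for the norm and L_k for the time spent by the walk on the sphere
    m = k.  The heart of the matter is that L_k has expectation of order k, in
    a strong sense: from every starting point it is at most C (k + 1)
    (occ_sphere_le), and from every starting point inside the sphere it is at
    least c k once k is large (occ_sphere_ge).  No asymptotics of the Green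
    function is involved.  If h >= 0 satisfies h - avg h >= g, where avg is the
    one-step averaging operator, then the expected sum of g along the walk is
    at most h; if h - avg h <= g and h is small at infinity, then it is
    essentially at least h.  So each bound amounts to exhibiting a function.

    For the upper bound, the function is a profile of the norm that is constant
    up to k and then decreases, at first with a slope of order one, more and
    more slowly, down to 0 at 2k + 1.  A norm satisfies
    m (x + e_i) + m (x - e_i) >= 2 m x, so that the profile is superharmonic
    up to an error of order 1/k beyond the sphere.  The error is absorbed by a
    multiple of (|x|^2 / (k + 1)^2 + 40^2) ^ (-1/3), which is strictly
    superharmonic because |x| ^ (-2/3) decays more slowly than the Green
    function |x| ^ (2 - d) for d >= 3.  For the lower bound, the cone k - m is
    subtracted, inside the ball, from a Gaussian of height and width of order
    k, with so large a rate that it is subharmonic away from the centre, and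
    the result is cut off from below by a constant.

    The upper bound and the identity sum_n f (m (S_n)) = sum_k f k L_k show
    that the additive functional has a finite expectation when k f k is
    summable; it is then finite almost surely.  For the converse, assume that
    sum_k k f k diverges.  The two bounds control the first two moments of the
    contribution to sum_n f (m (S_n)) of a block of spheres far away from the
    starting point; by the second moment method, the block contributes at
    least a given M with a probability at least 1 - q > 0 that depends neither
    on the block nor on the start (prob_below_uniform).  A walk that has failed
    to accumulate M is still within a bounded distance and can be tried again
    on a more distant block (prob_below_restart), hence
    P (sum < M) <= q ^ j for every j, and the sum is almost surely infinite.
    This repetition takes the place of a zero-one law, and it only needs the
    finite-dimensional distributions (path_law).

    Finally, the two numerical series have comparable terms, as the sphere of
    radius k has of the order of k ^ (d - 1) points (sphere_card_growth). *)

(** * Lattice norms *)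

Local Notation e_ i := (delta_mx ord0 i).

Definition sqnorm d (x : 'rV[int]_d) : nat := (\sum_(i < d) `|x ord0 i| ^ 2)%N.

(** What the estimates use of the max norm and of the l1-norm: every point has
    a neighbour that is farther out, norms of neighbours differ by at most one,
    the triangle inequality for 2x = (x + e_i) + (x - e_i), and comparison with
    the Euclidean norm.  The bounds below on the time spent on a sphere hold
    for every such function. *)
Record lattice_gauge d (nrm : 'rV[int]_d -> nat) : Prop := LatticeGauge {
  gauge_up : forall x, exists i,
    (nrm x < nrm (x + e_ i)%R)%N \/ (nrm x < nrm (x - e_ i)%R)%N;
  gauge_lipD : forall x i, (nrm (x + e_ i)%R <= (nrm x).+1)%N;
  gauge_lipB : forall x i, (nrm (x - e_ i)%R <= (nrm x).+1)%N;
  gauge_convex : forall x i,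
    ((nrm x).*2 <= nrm (x + e_ i)%R + nrm (x - e_ i)%R)%N;
  gauge_sqnorm : forall x, (sqnorm x <= d * nrm x ^ 2)%N;
  sqnorm_gauge : forall x, (nrm x ^ 2 <= d ^ 2 * sqnorm x)%N }.

Lemma stepE d (x : 'rV[int]_d) i j :
  (x + e_ i) ord0 j = x ord0 j + (i == j)%:R.
Proof. by rewrite !mxE eqxx eq_sym. Qed.

Lemma stepNE d (x : 'rV[int]_d) i j :
  (x - e_ i) ord0 j = x ord0 j - (i == j)%:R.
Proof. by rewrite !mxE eqxx eq_sym. Qed.

Lemma absz_le_sqnorm d (x : 'rV[int]_d) i : (`|x ord0 i| ^ 2 <= sqnorm x)%N.
Proof. by rewrite /sqnorm (bigD1 i) //= leq_addr. Qed.

Lemma le_max_norm d (x : 'rV[int]_d) i : (`|x ord0 i| <= max_norm x)%N.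
Proof. by rewrite /max_norm (bigD1 i) //= leq_maxl. Qed.

Lemma max_norm_le d (x : 'rV[int]_d) n :
  (forall i, `|x ord0 i| <= n)%N -> (max_norm x <= n)%N.
Proof. by move=> h; apply/bigmax_leqP => i _. Qed.

Lemma max_norm_attained d (x : 'rV[int]_d) : (0 < d)%N ->
  exists i, max_norm x = `|x ord0 i|%N.
Proof.
move=> d0; have [|i h] := @bigop.eq_bigmax _ (fun i => `|x ord0 i|%N).
  by rewrite card_ord.
by exists i.
Qed.

Lemma max_norm_gauge d : (0 < d)%N -> lattice_gauge (@max_norm d).
Proof.
move=> d0; split.
- move=> x; have [i hi] := max_norm_attained x d0; exists i.
  have := le_max_norm (x + e_ i) i; have := le_max_norm (x - e_ i) i.
  by rewrite stepE stepNE eqxx hi; lia.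
- move=> x i; apply: max_norm_le => j; rewrite stepE.
  by have := le_max_norm x j; case: (i == j) => /=; lia.
- move=> x i; apply: max_norm_le => j; rewrite stepNE.
  by have := le_max_norm x j; case: (i == j) => /=; lia.
- move=> x i; have [j ->] := max_norm_attained x d0.
  have := le_max_norm (x + e_ i) j; have := le_max_norm (x - e_ i) j.
  by rewrite stepE stepNE; lia.
- move=> x; rewrite /sqnorm; apply: (@leq_trans (\sum_(i < d) max_norm x ^ 2)).
    by apply: leq_sum => i _; rewrite leq_exp2r // le_max_norm.
  by rewrite sum_nat_const card_ord.
- move=> x; have [i ->] := max_norm_attained x d0.
  apply: (leq_trans (absz_le_sqnorm x i)).
  by rewrite leq_pmull // expn_gt0 d0.
Qed.

Lemma l1_norm_gauge d : (0 < d)%N -> lattice_gauge (@l1_norm d).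
Proof.
move=> d0.
have split1 (x : 'rV[int]_d) i :
    l1_norm x = (`|x ord0 i| + \sum_(j < d | j != i) `|x ord0 j|)%N.
  by rewrite /l1_norm (bigD1 i).
have splitD (x : 'rV[int]_d) i : l1_norm (x + e_ i) =
    (`|(x ord0 i + 1)%R| + \sum_(j < d | j != i) `|x ord0 j|)%N.
  rewrite (split1 _ i) stepE eqxx; congr (_ + _)%N.
  by apply: eq_bigr => j ji; rewrite stepE eq_sym (negPf ji) addr0.
have splitB (x : 'rV[int]_d) i : l1_norm (x - e_ i) =
    (`|(x ord0 i - 1)%R| + \sum_(j < d | j != i) `|x ord0 j|)%N.
  rewrite (split1 _ i) stepNE eqxx; congr (_ + _)%N.
  by apply: eq_bigr => j ji; rewrite stepNE eq_sym (negPf ji) subr0.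
split.
- move=> x; exists (Ordinal d0).
  rewrite splitD splitB (split1 x (Ordinal d0)).
  by have [h|h] := lerP 0 (x ord0 (Ordinal d0)); [left|right]; lia.
- by move=> x i; rewrite splitD (split1 x i); lia.
- by move=> x i; rewrite splitB (split1 x i); lia.
- by move=> x i; rewrite splitD splitB (split1 x i); lia.
- move=> x; rewrite /sqnorm; apply: (@leq_trans (\sum_(i < d) l1_norm x ^ 2)).
    by apply: leq_sum => i _; rewrite leq_exp2r // (split1 x i) leq_addr.
  by rewrite sum_nat_const card_ord.
- move=> x; have [i hi] := max_norm_attained x d0.
  have h : (l1_norm x <= d * `|x ord0 i|)%N.
    apply: (@leq_trans (\sum_(j < d) `|x ord0 i|)%N).
      by apply: leq_sum => j _; rewrite -hi le_max_norm.
    by rewrite sum_nat_const card_ord.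
  apply: (@leq_trans ((d * `|x ord0 i|) ^ 2)); first by rewrite leq_exp2r.
  by rewrite expnMn leq_mul2l absz_le_sqnorm orbT.
Qed.

(** * One-step averages and expected occupation *)

Section averaging.
Context {R : realType} {d : nat}.
Implicit Types (g h : 'rV[int]_d -> R) (x : 'rV[int]_d) (N : nat).

Definition avg g x : R :=
  (2 * d)%:R^-1 * \sum_(i < d) (g (x + e_ i) + g (x - e_ i)).

Lemma avg_le_step g h x : (forall i, g (x + e_ i) <= h (x + e_ i)) ->
  (forall i, g (x - e_ i) <= h (x - e_ i)) -> avg g x <= avg h x.
Proof.
move=> ghD ghB; rewrite ler_wpM2l ?invr_ge0//; apply: ler_sum => i _.
exact: lerD.
Qed.

Lemma avg_le g h x : (forall y, g y <= h y) -> avg g x <= avg h x.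
Proof. by move=> gh; apply: avg_le_step => i. Qed.

Lemma eq_avg g h x : g =1 h -> avg g x = avg h x.
Proof. by move=> gh; congr (_ * _); apply: eq_bigr => i _; rewrite !gh. Qed.

Lemma avgD g h x : avg (fun y => g y + h y) x = avg g x + avg h x.
Proof.
rewrite /avg -mulrDr -big_split/=; congr (_ * _); apply: eq_bigr => i _.
by rewrite addrACA.
Qed.

Lemma avgZ (a : R) g x : avg (fun y => a * g y) x = a * avg g x.
Proof.
rewrite /avg [RHS]mulrCA [in RHS]mulr_sumr; congr (_ * _); apply: eq_bigr => i _.
by rewrite mulrDr.
Qed.

Lemma avg_sum I (r : seq I) (G : I -> 'rV[int]_d -> R) x :
  avg (fun y => \sum_(k <- r) G k y) x = \sum_(k <- r) avg (G k) x.
Proof.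
rewrite /avg -mulr_sumr [in RHS]exchange_big/=; congr (_ * _).
by apply: eq_bigr => i _; rewrite big_split.
Qed.

Lemma avg0 x : avg (fun=> 0) x = 0.
Proof. by rewrite /avg big1 ?mulr0 // => i _; rewrite addr0. Qed.

Lemma avg_ge0 g x : (forall y, 0 <= g y) -> 0 <= avg g x.
Proof. by move=> g0; rewrite -(avg0 x); apply: avg_le. Qed.

Hypothesis d_gt0 : (0 < d)%N.

Lemma avg_cst (c : R) x : avg (fun=> c) x = c.
Proof.
have d0 : (2 * d)%:R != 0 :> R by rewrite pnatr_eq0; lia.
by rewrite /avg sumr_const card_ord -mulr2n -mulrnA -[c *+ _]mulr_natl mulKf.
Qed.

Lemma avg_lecst g x (c : R) : (forall y, g y <= c) -> avg g x <= c.
Proof. by move=> gc; rewrite -[leRHS](avg_cst c x); apply: avg_le. Qed.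

(** The expected sum of g over the positions at times 0, ..., N - 1 of the
    walk started from x: [iter n avg g x] is the expectation of g at time n. *)
Definition occ N g x : R := \sum_(0 <= n < N) iter n avg g x.

Lemma iter_avg_le n g h x : (forall y, g y <= h y) ->
  iter n avg g x <= iter n avg h x.
Proof. by move=> gh; elim: n x => //= n IH x; apply: avg_le. Qed.

Lemma iter_avg_ge0 n g x : (forall y, 0 <= g y) -> 0 <= iter n avg g x.
Proof. by move=> g0; elim: n x => //= n IH x; apply: avg_ge0. Qed.

Lemma iter_avgD n g h x :
  iter n avg (fun y => g y + h y) x = iter n avg g x + iter n avg h x.
Proof. by elim: n x => //= n IH x; rewrite -avgD; apply: eq_avg. Qed.

Lemma iter_avgZ n (a : R) g x :
  iter n avg (fun y => a * g y) x = a * iter n avg g x.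
Proof. by elim: n x => //= n IH x; rewrite -avgZ; apply: eq_avg. Qed.

Lemma iter_avg_sum n I (r : seq I) (G : I -> 'rV[int]_d -> R) x :
  iter n avg (fun y => \sum_(k <- r) G k y) x =
  \sum_(k <- r) iter n avg (G k) x.
Proof. by elim: n x => //= n IH x; rewrite -avg_sum; apply: eq_avg. Qed.

Lemma iter_avg_cst n (c : R) x : iter n avg (fun=> c) x = c.
Proof.
by elim: n x => //= n IH x; rewrite -[RHS](avg_cst c x); apply: eq_avg.
Qed.

Lemma occ0 g x : occ 0 g x = 0. Proof. by rewrite /occ big_nil. Qed.

Lemma occS N g x : occ N.+1 g x = g x + avg (occ N g) x.
Proof. by rewrite /occ big_nat_recl//= avg_sum. Qed.

Lemma occ_mono N M g x : (forall y, 0 <= g y) -> (N <= M)%N ->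
  occ N g x <= occ M g x.
Proof.
move=> g0 NM; rewrite /occ (big_cat_nat _ NM)//= lerDl.
by apply: sumr_ge0 => n _; apply: iter_avg_ge0.
Qed.

Lemma occ_sum N I (r : seq I) (G : I -> 'rV[int]_d -> R) x :
  occ N (fun y => \sum_(k <- r) G k y) x = \sum_(k <- r) occ N (G k) x.
Proof.
rewrite /occ exchange_big/=; apply: eq_bigr => n _; exact: iter_avg_sum.
Qed.

Lemma occZ N (a : R) g x : occ N (fun y => a * g y) x = a * occ N g x.
Proof.
by rewrite /occ mulr_sumr; apply: eq_bigr => n _; rewrite iter_avgZ.
Qed.

(** Along the walk, h minus the sum of g collected so far is a
    supermartingale, and h >= 0 discards its terminal value.  The next lemma
    is the opposite inequality, where the terminal value has to be kept. *)
Lemma occ_le_superharmonic g h : (forall x, 0 <= h x) ->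
  (forall x, g x + avg h x <= h x) -> forall N x, occ N g x <= h x.
Proof.
move=> h0 gh; elim=> [|N IH] x; first by rewrite occ0.
by rewrite occS (le_trans _ (gh x))// lerD2l; apply: avg_le.
Qed.

Lemma occ_ge_subharmonic g h : (forall x, h x <= g x + avg h x) ->
  forall N x, h x <= occ N g x + iter N avg h x.
Proof.
move=> gh N; elim: N => [|N IH] x; first by rewrite occ0 add0r.
rewrite occS (le_trans (gh x))// -addrA lerD2l /= -avgD.
exact: avg_le.
Qed.

End averaging.

(** * A superharmonic function at a given scale *)

Section superharmonic.
Context {R : realType}.

(** In dimension d, (|x|^2) ^ alpha is harmonic for alpha = (2 - d) / 2 <= -1/2.
    An exponent strictly between -1/2 and 0 leaves room for the errors of second
    order expansions, and for -1/3 such an expansion can be checked by comparing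
    cubes, which are rational functions. *)
Definition invcbrt (y : R) : R := y `^ (- 3%:R^-1).

Lemma invcbrt_gt0 y : 0 < y -> 0 < invcbrt y.
Proof. by move=> y0; rewrite powR_gt0. Qed.

Lemma invcbrtK y : 0 < y -> invcbrt y ^+ 3 = y^-1.
Proof.
move=> y0; rewrite -powR_mulrn ?powR_ge0// -powRrM mulNr mulVf ?pnatr_eq0//.
by rewrite powR_inv1// ltW.
Qed.

Lemma invcbrt_le y z : 0 < y -> y <= z -> invcbrt z <= invcbrt y.
Proof.
move=> y0 yz; have z0 : 0 < z by exact: lt_le_trans yz.
rewrite -(@ler_pXn2r _ 3) ?nnegrE ?powR_ge0// !invcbrtK//.
by rewrite lef_pV2 ?posrE.
Qed.

Lemma invcbrt_le1 y : 1 <= y -> invcbrt y <= 1.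
Proof.
move=> y1; have y0 : 0 < y by exact: lt_le_trans y1.
rewrite -(@ler_pXn2r _ 3) ?nnegrE ?powR_ge0// invcbrtK// expr1n.
by rewrite invf_le1.
Qed.

(** The second order Taylor polynomial has the coefficient 2/9 < 6/25; the
    difference pays for the cubic term as long as |u| <= 1/20. *)
Lemma invcbrt_quadratic y u : 0 < y -> `|u| <= 20^-1 ->
  invcbrt (y * (1 + u)) <= invcbrt y * (1 - u / 3 + 6 / 25 * u ^+ 2).
Proof.
move=> y0; rewrite ler_norml => /andP[u1 u2].
have v0 : 0 < 1 + u by lra.
have q0 : 0 <= 1 - u / 3 + 6 / 25 * u ^+ 2.
  by have := sqr_ge0 u; lra.
rewrite -(@ler_pXn2r _ 3) ?nnegrE ?mulr_ge0 ?powR_ge0//.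
rewrite exprMn !invcbrtK ?mulr_gt0// invfM.
rewrite ler_pM2l ?invr_gt0//.
rewrite -[leLHS]div1r ler_pdivrMr// -subr_ge0.
(* In the difference the terms of order 0 and 1 cancel, and the coefficient 4/75
   of u ^ 2 dominates the others. *)
set t := (X in 0 <= X).
have -> : t = u ^+ 2 * ((4 / 75)
    + u * ((362 / 675)
    + u * ((- (4459 / 16875))
    + u * ((122 / 625)
    + u * ((- (684 / 15625))
    + u * ((216 / 15625))))))).
  by rewrite /t; field.
apply: mulr_ge0; first exact: sqr_ge0.
by nra.
Qed.

Section at_scale.
Context {d : nat}.
Hypothesis d_ge3 : (3 <= d)%N.
Implicit Types (x : 'rV[int]_d) (K : R).

Let dR : 3 <= d%:R :> R. Proof. by rewrite (ler_nat R 3 d). Qed.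

Lemma natr_absz_sqr (z : int) : (`|z| ^ 2)%N%:R = z%:~R ^+ 2 :> R.
Proof. by rewrite natrX natr_absz intr_norm real_normK ?num_real. Qed.

Lemma sqnormE x : (sqnorm x)%:R = \sum_(i < d) ((x ord0 i)%:~R ^+ 2 : R).
Proof. by rewrite natr_sum; apply: eq_bigr => i _; rewrite natr_absz_sqr. Qed.

Lemma sqnormD x i : (sqnorm (x + e_ i))%:R =
  (sqnorm x)%:R + (1 + 2 * (x ord0 i)%:~R) :> R.
Proof.
rewrite !sqnormE (bigD1 i)//= [in RHS](bigD1 i)//= stepE eqxx intrD.
rewrite (eq_bigr (fun j => (x ord0 j)%:~R ^+ 2)); first by rewrite mulr1z; ring.
by move=> j ji; rewrite stepE eq_sym (negPf ji) addr0.
Qed.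

Lemma sqnormB x i : (sqnorm (x - e_ i))%:R =
  (sqnorm x)%:R + (1 - 2 * (x ord0 i)%:~R) :> R.
Proof.
rewrite !sqnormE (bigD1 i)//= [in RHS](bigD1 i)//= stepNE eqxx intrB.
rewrite (eq_bigr (fun j => (x ord0 j)%:~R ^+ 2)); first by rewrite mulr1z; ring.
by move=> j ji; rewrite stepNE eq_sym (negPf ji) subr0.
Qed.

(** The constant 40 ^ 2 keeps the relative variation of [scaled] in one step
    below 1/20, at every scale K >= 1 (see coordinate_small). *)
Definition scaled K x : R := (sqnorm x)%:R / K ^+ 2 + 40 ^+ 2.

Definition potential K x : R := K ^+ 2 * invcbrt (scaled K x).

Lemma scaled_ge K x : 40 ^+ 2 <= scaled K x.
Proof. by rewrite lerDr divr_ge0 ?sqr_ge0. Qed.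

Lemma scaledE K x : K != 0 ->
  K ^+ 2 * scaled K x = (sqnorm x)%:R + 40 ^+ 2 * K ^+ 2.
Proof.
move=> K0; rewrite /scaled mulrDr [_ * (_ / _)]mulrC divfK ?expf_neq0//.
by rewrite [_ * 40 ^+ 2]mulrC.
Qed.

Lemma scaled_gt0 K x : 0 < scaled K x.
Proof. by apply: lt_le_trans (scaled_ge K x); rewrite exprn_gt0 ?ltr0n. Qed.

Lemma potential_ge0 K x : 0 <= potential K x.
Proof. by rewrite mulr_ge0 ?sqr_ge0 ?powR_ge0. Qed.

Lemma potential_le K x : potential K x <= K ^+ 2.
Proof.
rewrite ler_piMr ?sqr_ge0// invcbrt_le1//.
by apply: le_trans (scaled_ge K x); rewrite exprn_ege1 ?ler1n.
Qed.

(** If s = 1 or -1, the step from x to x + s e_i multiplies [scaled] by 1 + u,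
    where u is the quantity bounded here.  The bound is AM-GM:
    40 |x_i| <= x_i ^ 2 + 20 ^ 2. *)
Lemma coordinate_small K x i (s : R) : 1 <= K -> s ^+ 2 = 1 ->
  `|(1 + s * (2 * (x ord0 i)%:~R)) / (K ^+ 2 * scaled K x)| <= 20^-1.
Proof.
move=> K1 s1; set c := (x ord0 i)%:~R : R.
have K0 : 0 < K ^+ 2 by rewrite exprn_gt0// (lt_le_trans _ K1).
have KK : 1 <= K ^+ 2 by rewrite exprn_ege1.
have rE : K ^+ 2 * scaled K x = (sqnorm x)%:R + 40 ^+ 2 * K ^+ 2.
  by rewrite scaledE// gt_eqF// (lt_le_trans _ K1).
have r0 : 0 < K ^+ 2 * scaled K x by rewrite mulr_gt0// scaled_gt0.
rewrite normrM normfV (gtr0_norm r0) ler_pdivrMr// rE.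
have c2 : c ^+ 2 <= (sqnorm x)%:R.
  by rewrite -natr_absz_sqr ler_nat absz_le_sqnorm.
have : `|1 + s * (2 * c)| ^+ 2 <= (20^-1 * (c ^+ 2 + 40 ^+ 2)) ^+ 2.
  rewrite real_normK ?num_real//.
  have := sqr_ge0 (c ^+ 2).
  have -> : (1 + s * (2 * c)) ^+ 2 = 1 + 4 * s * c + 4 * s ^+ 2 * c ^+ 2.
    by ring.
  by rewrite s1; have := sqr_ge0 c; nra.
rewrite ler_pXn2r ?nnegrE//; last first.
  by have := sqr_ge0 c; lra.
by move/le_trans; apply; rewrite ler_wpM2l ?invr_ge0//; lra.
Qed.

Lemma potential_step K x i (s : R) (y : 'rV[int]_d) : 1 <= K -> s ^+ 2 = 1 ->
  (sqnorm y)%:R = (sqnorm x)%:R + (1 + s * (2 * (x ord0 i)%:~R)) :> R ->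
  forall u, u = (1 + s * (2 * (x ord0 i)%:~R)) / (K ^+ 2 * scaled K x) ->
  potential K y <= potential K x * (1 - u / 3 + 6 / 25 * u ^+ 2).
Proof.
move=> K1 s1 yE u uE.
have K0 : 0 < K ^+ 2 by rewrite exprn_gt0// (lt_le_trans _ K1).
have -> : potential K y = K ^+ 2 * invcbrt (scaled K x * (1 + u)).
  have s0 : scaled K x != 0 by rewrite gt_eqF// scaled_gt0.
  have K0' : K != 0 by rewrite gt_eqF// (lt_le_trans _ K1).
  congr (_ * invcbrt _); rewrite mulrDr mulr1 [in LHS]/scaled yE uE.
  rewrite {1}/scaled; field; by rewrite s0 K0'.
rewrite [potential K x]/potential -[leRHS]mulrA ler_pM2l// invcbrt_quadratic ?scaled_gt0// uE.
exact: coordinate_small.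
Qed.

(** Summing the quadratic bounds over the 2d steps, the first order terms give
    - 1 / (3 r) and the second order ones (24 / 25) / (d r) up to O(1 / r ^ 2),
    with r = K ^ 2 * scaled K x.  As 24 / 25 < 1 <= d / 3, the former win:
    this is where the walk has to be transient. *)
Lemma avg_potential K x : 1 <= K ->
  avg (potential K) x <=
    potential K x * (1 - (150 * (K ^+ 2 * scaled K x))^-1).
Proof.
move=> K1; set V := potential K x; set r := K ^+ 2 * scaled K x.
have K0 : 0 < K ^+ 2 by rewrite exprn_gt0// (lt_le_trans _ K1).
have KK : 1 <= K ^+ 2 by rewrite exprn_ege1.
have V0 : 0 <= V by exact: potential_ge0.
have rE : r = (sqnorm x)%:R + 40 ^+ 2 * K ^+ 2.
  by rewrite /r /scaled mulrDr mulrC divfK ?gt_eqF// [in RHS]mulrC.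
have r1600 : 40 ^+ 2 <= r by rewrite rE; have : 0 <= (sqnorm x)%:R :> R by []; lra.
have r0 : 0 < r by lra.
have pairV i : potential K (x + e_ i) + potential K (x - e_ i) <=
    V * (2 - 2 / 3 * r^-1
         + 6 / 25 * (2 + 8 * (x ord0 i)%:~R ^+ 2) * r^-1 ^+ 2).
  have hD := @potential_step K x i 1 (x + e_ i) K1 (expr1n _ _).
  have hB := @potential_step K x i (-1) (x - e_ i) K1 (sqrr_sign _ 1).
  rewrite mul1r mulN1r in hD hB.
  have := lerD (hD (sqnormD x i) _ erefl) (hB (sqnormB x i) _ erefl) => /le_trans; apply.
  rewrite -/V -/r -mulrDr ler_wpM2l// le_eqVlt; apply/orP; left; apply/eqP.
  by ring.
have d0 : 0 < (2 * d)%:R :> R by rewrite ltr0n; lia.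
rewrite /avg mulrC ler_pdivrMr//.
apply: le_trans (ler_sum _ (fun i _ => pairV i)) _.
rewrite -mulr_sumr -[leRHS]mulrA ler_wpM2l//.
rewrite big_split/= sumr_const card_ord -mulr_suml -mulr_sumr big_split/=.
rewrite sumr_const card_ord -mulr_sumr -sqnormE -[_ *+ d]mulr_natl.
rewrite -[2 *+ d]mulr_natl natrM.
set D := d%:R : R; set q := (sqnorm x)%:R : R.
have D3 : 3 <= D by exact: dR.
have q0 : 0 <= q by rewrite /q.
have qr : q <= r by rewrite rE -/q; lra.
rewrite -subr_ge0; set t := (X in 0 <= X).
have -> : t = r^-1 ^+ 2 * (D * (2 / 3 - 2 / 150) * r - 6 / 25 * (2 * D + 8 * q)).
  rewrite /t invfM; field; by rewrite gt_eqF.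
by rewrite mulr_ge0 ?sqr_ge0//; nra.
Qed.

(** A bound for the decrease that does not depend on K, valid in a ball of
    radius of order K. *)
Definition potential_drop : R :=
  invcbrt (4 * d%:R + 40 ^+ 2) / (150 * (4 * d%:R + 40 ^+ 2)).

Lemma potential_drop_gt0 : 0 < potential_drop.
Proof. by have := dR; rewrite divr_gt0 ?invcbrt_gt0//; lra. Qed.

Lemma potential_superharmonic K x : 1 <= K ->
  avg (potential K) x <= potential K x.
Proof.
move=> K1; apply: le_trans (avg_potential x K1) _.
rewrite ler_piMr ?potential_ge0// lerBlDr lerDl invr_ge0.
by rewrite mulr_ge0// mulr_ge0 ?sqr_ge0 ?ltW ?scaled_gt0.
Qed.

Lemma potential_dropP K x : 1 <= K -> (sqnorm x)%:R <= d%:R * (2 * K) ^+ 2 ->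
  avg (potential K) x + potential_drop <= potential K x.
Proof.
move=> K1 xK; have := avg_potential x K1; rewrite mulrBr mulr1.
suff : potential_drop <= potential K x / (150 * (K ^+ 2 * scaled K x)) by lra.
have K0 : 0 < K ^+ 2 by rewrite exprn_gt0// (lt_le_trans _ K1).
have s0 := scaled_gt0 K x.
have -> : potential K x / (150 * (K ^+ 2 * scaled K x)) =
          invcbrt (scaled K x) / (150 * scaled K x).
  by rewrite /potential; field; rewrite !gt_eqF// (lt_le_trans _ K1).
have sB : scaled K x <= 4 * d%:R + 40 ^+ 2.
  rewrite lerD2r ler_pdivrMr//; apply: le_trans xK _.
  by rewrite exprMn mulrA [_ * 2 ^+ 2]mulrC -natrX.
rewrite /potential_drop ler_pM ?powR_ge0//.
- exact: invcbrt_le.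
- by rewrite lef_pV2 ?posrE; lra.
Qed.

End at_scale.
End superharmonic.

(** * Upper bound for the time spent on a sphere *)

(** A profile that is constant up to k and then decreases, convexly, to 0 at
    2k + 1; the truncated subtractions perform both cut-offs. *)
Definition tent k m : nat := ((k.+1 - (m - k)) ^ 2)%N.

(** Here m, a, b are the norms of x, x + e_i, x - e_i.  At m = k a step outwards
    loses (k + 1) ^ 2 - k ^ 2 = 2k + 1 and a step inwards gains nothing.  Beyond k,
    the profile is decreasing and 2m <= a + b, so that only its second
    difference, at most 2, counts against superharmonicity. *)
Lemma tent_pair k m a b : (a <= m.+1)%N -> (b <= m.+1)%N -> (m.*2 <= a + b)%N ->
  (tent k a + tent k b + (2 * k).+1 * ((m == k) && ((m < a) || (m < b)))
    <= 2 * tent k m + 2 * (k < m <= (2 * k).+1))%N.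
Proof.
move=> am bm mab.
have mono i j : (i <= j)%N -> (tent k j <= tent k i)%N.
  by move=> ij; rewrite /tent leq_exp2r// leq_sub2l// leq_sub2r.
have const i : (i <= k)%N -> tent k i = (k.+1 ^ 2)%N.
  by rewrite -subn_eq0 /tent => /eqP ->; rewrite subn0.
have tentS i j : (k <= i)%N -> (i + j = (2 * k).+1)%N -> tent k i = (j ^ 2)%N.
  by move=> ki ij; rewrite /tent; congr (_ ^ _)%N; lia.
have tent0 i : ((2 * k).+1 <= i)%N -> tent k i = 0%N.
  by move=> ki; rewrite /tent (_ : _ - _ = 0)%N; lia.
have [mk|km|mk] := ltngtP m k.
- by rewrite !const; lia.
- have [m2|m2] := leqP m (2 * k).+1; last by rewrite !tent0; lia.
  have ? : ((a == m.+1) || (a == m) || (a.+1 == m))%N by lia.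
  have ? : ((b == m.+1) || (b == m) || (b.+1 == m))%N by lia.
  have [j jE] : exists j, (m + j = (2 * k).+1)%N by exists ((2 * k).+1 - m)%N; lia.
  rewrite (tentS m j) ?muln0 ?addn0 ?muln1; [|lia|lia].
  have hp i : (i.+1 == m)%N -> tent k i = (j.+1 ^ 2)%N by move=> ?; apply: tentS; lia.
  have hn i : (i == m.+1)%N -> tent k i = (j.-1 ^ 2)%N.
    move=> /eqP ->; case: (j) jE => [|j'] jE; first by rewrite tent0; lia.
    by apply: tentS; lia.
  have [/eqP aE|am1] := eqVneq a m.+1.
    rewrite (hn a aE); apply: (@leq_trans (j.-1 ^ 2 + j.+1 ^ 2)%N); last first.
      by case: (j) => //= ?; nia.
    rewrite leq_add2l -(hp m.-1) ?mono; lia.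
  have [/eqP bE|bm1] := eqVneq b m.+1.
    rewrite (hn b bE) addnC; apply: (@leq_trans (j.-1 ^ 2 + j.+1 ^ 2)%N); last first.
      by case: (j) => //= ?; nia.
    rewrite leq_add2l -(hp m.-1) ?mono; lia.
  by have := mono m a; have := mono m b; rewrite (tentS m j); lia.
- subst m; rewrite ?ltnn ?eqxx /= ?muln0 ?addn0.
  have tk1 : (tent k k.+1 + (2 * k).+1 = k.+1 ^ 2)%N.
    by rewrite (tentS _ k); nia.
  have hk i : (tent k i <= k.+1 ^ 2)%N by rewrite -(const 0%N) ?mono.
  rewrite (const k)//.
  have [ka|ka] /= := ltnP k a.
    have -> : a = k.+1 by lia.
    by have := hk b; lia.
  have [kb|kb] := ltnP k b.
    have -> : b = k.+1 by lia.
    by have := hk a; lia.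
  by have := hk a; have := hk b; lia.
Qed.

Section occupation_upper.
Context {R : realType} {d : nat}.
Hypothesis d_ge3 : (3 <= d)%N.
Variable nrm : 'rV[int]_d -> nat.
Hypothesis gauge : lattice_gauge nrm.

Lemma tent_step k x :
  avg (fun y => (tent k (nrm y))%:R) x
    + (2 * d)%:R^-1 * k.+1%:R * (nrm x == k)%:R
  <= (tent k (nrm x))%:R + (k < nrm x <= (2 * k).+1)%N%:R :> R.
Proof.
have d0 : 0 < (2 * d)%:R :> R by rewrite ltr0n; lia.
rewrite /avg -mulrA -mulrDr mulrC ler_pdivrMr// -natrM.
under eq_bigr => i _ do rewrite -natrD.
rewrite -natr_sum -!natrD -natrM ler_nat.
set m := nrm x; set up := fun i => (m < nrm (x + e_ i)%R)%N || (m < nrm (x - e_ i)%R)%N.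
have -> : ((tent k m + (k < m <= (2 * k).+1)) * (2 * d) =
   \sum_(i < d) (2 * tent k m + 2 * (k < m <= (2 * k).+1)))%N.
  by rewrite sum_nat_const card_ord; lia.
apply: leq_trans; last first.
  by apply: leq_sum => i _; apply: (@tent_pair k m _ _ (gauge_lipD gauge x i)
    (gauge_lipB gauge x i) (gauge_convex gauge x i)).
rewrite [leqRHS]big_split/= leq_add2l.
have [i0 iup] : exists i, up i.
  by have [i [h|h]] := gauge_up gauge x; exists i; rewrite /up /m h ?orbT.
rewrite (bigD1 i0)//= -/(up i0) iup andbT.
apply: leq_trans (leq_addr _ _); rewrite leq_mul2r; lia.
Qed.

(** The kink of the profile at k is of order k and its convexity of order 1, so
    after division by k + 1 the kink dominates the indicator of the sphere and
    the error, of order 1 / k, is compensated by the potential at scale k + 1,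
    divided by k + 1.  Both terms are at most of order k + 1. *)
Lemma occ_sphere_le : exists2 C : R, 0 < C & forall k N x,
  occ N (fun y => (nrm y == k)%:R) x <= C * k.+1%:R.
Proof.
have d0 : 0 < (2 * d)%:R :> R by rewrite ltr0n; lia.
have [del0 drop] := (@potential_drop_gt0 R d d_ge3, @potential_dropP R d d_ge3).
set del := potential_drop in del0 drop.
exists ((2 * d)%:R * (1 + del^-1)); first by rewrite mulr_gt0// addr_gt0 ?invr_gt0.
move=> k N x; set K := k.+1%:R : R.
have K0 : 0 < K by rewrite ltr0n.
have K1 : 1 <= K by rewrite ler1n.
pose h y : R := (2 * d)%:R * K^-1 * ((tent k (nrm y))%:R + del^-1 * potential K y).
have h0 y : 0 <= h y.
  have v0 : 0 <= del^-1 * potential K y.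
    by rewrite mulr_ge0 ?potential_ge0// invr_ge0 ltW.
  by rewrite /h mulr_ge0 ?addr_ge0// mulr_ge0 ?invr_ge0 ?ltW.
apply: (@le_trans _ _ (h x)).
  apply: occ_le_superharmonic => // y.
  rewrite /h avgZ avgD avgZ.
  have drop' : avg (potential K) y + del * (k < nrm y <= (2 * k).+1)%N%:R <= potential K y.
    have [/andP[_ h2]|_] := boolP (k < nrm y <= (2 * k).+1)%N; last first.
      by rewrite mulr0 addr0; exact: potential_superharmonic.
    rewrite mulr1; apply: drop => //.
    apply: (@le_trans _ _ (d * nrm y ^ 2)%:R).
      by rewrite ler_nat (gauge_sqnorm gauge).
    rewrite natrM ler_wpM2l// natrX -natrM ler_pXn2r ?nnegrE//.
    by rewrite ler_nat; lia.
  have dropV : del^-1 * avg (potential K) y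
      + (k < nrm y <= (2 * k).+1)%N%:R <= del^-1 * potential K y.
    rewrite -(ler_pM2l del0) mulrDr !mulrA divff ?gt_eqF// !mul1r.
    exact: drop'.
  have := lerD (tent_step k y) dropV.
  set a := avg (fun _ => (tent _ _)%:R) y; set b := del^-1 * avg _ y.
  set c := (nrm y == k)%:R; set e := (k < nrm y <= (2 * k).+1)%N%:R.
  set v := del^-1 * potential _ _; set t := (tent k (nrm y))%:R.
  rewrite -/K => hh.
  have : (2 * d)%:R * K^-1 * (a + b + (2 * d)%:R^-1 * K * c) <=
         (2 * d)%:R * K^-1 * (t + v).
    by apply: ler_wpM2l; [rewrite mulr_ge0 ?invr_ge0 ?ltW|lra].
  apply: le_trans.
  have qK : (2 * d)%:R * K^-1 * ((2 * d)%:R^-1 * K) = 1.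
    by rewrite mulrACA divff ?mulVf ?mulr1// gt_eqF.
  by rewrite [leRHS]mulrDr [_ * (_ * c)]mulrA qK mul1r addrC.
rewrite /h -[leLHS]mulrA -[leRHS]mulrA ler_pM2l// [leLHS]mulrC ler_pdivrMr//.
have t_le : (tent k (nrm x))%:R <= K ^+ 2.
  by rewrite /K -natrX ler_nat /tent leq_exp2r// leq_subr.
have v_le : del^-1 * potential K x <= del^-1 * K ^+ 2.
  by rewrite ler_pM2l ?invr_gt0// potential_le.
by rewrite -mulrA -expr2 mulrDl mul1r; lra.
Qed.

End occupation_upper.

(** * Lower bound for the time spent on a sphere *)

Section occupation_lower.
Context {R : realType} {d : nat}.
Hypothesis d_ge3 : (3 <= d)%N.

Let d_gt0 : (0 < d)%N. Proof. lia. Qed.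
Let dR0 : 0 < d%:R :> R. Proof. by rewrite ltr0n. Qed.

(** The square of e ^ s - e ^ (- s) >= s, where s = t / 2. *)
Lemma cosh_ge (t : R) : 2 + t ^+ 2 / 4 <= expR t + expR (- t).
Proof.
wlog t0 : t / 0 <= t.
  move=> h; have [|/ltW t0] := leP 0 t; first exact: h.
  have := h (- t); rewrite oppr_ge0 t0 sqrrN opprK [expR (- t) + _]addrC.
  exact.
have tE : t = t / 2 + t / 2 by lra.
set s := t / 2 in tE; have s0 : 0 <= s by rewrite divr_ge0.
have es : expR (- s) <= 1 by rewrite expR_le1 oppr_le0.
have diff : s <= expR s - expR (- s) by have := expR_ge1Dx s; lra.
have ee : expR s * expR (- s) = 1 by rewrite -expRD subrr expR0.
have := ler_pM s0 s0 diff diff.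
have ssE : expR (- (s + s)) = expR (- s) ^+ 2 by rewrite opprD expRD expr2.
by rewrite -!expr2 sqrrB ee tE ssE expRD -!expr2; lra.
Qed.

Section gaussian.
Variables (nrm : 'rV[int]_d -> nat) (gauge : lattice_gauge nrm).
Variable k : nat.
Hypothesis k_large : (32 * d ^ 3 <= k ^ 2)%N.

(* A Gaussian exp (- r |x|^2) is subharmonic where r |x|^2 is large; the factor
   16 d ^ 3 makes this happen already for nrm x >= k / 2, where
   |x| >= k / (2 d). *)
Let rate : R := 16 * d%:R ^+ 3 / k%:R ^+ 2.

Let k_gt0 : (0 < k)%N.
Proof.
by move: k_large; case: (k) => //; rewrite exp0n// leqn0 muln_eq0 expn_eq0; lia.
Qed.

Let kR0 : 0 < k%:R :> R. Proof. by rewrite ltr0n k_gt0. Qed.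

Let rate_ge0 : 0 <= rate.
Proof. by rewrite /rate divr_ge0 ?sqr_ge0// mulr_ge0// exprn_ge0. Qed.

Let rate_le : rate <= 2^-1.
Proof.
rewrite /rate ler_pdivrMr ?exprn_gt0//.
have : (32 * d ^ 3)%:R <= (k ^ 2)%:R :> R by rewrite ler_nat.
by rewrite natrM !natrX; lra.
Qed.

Definition gauss (x : 'rV[int]_d) : R := expR (- (rate * (sqnorm x)%:R)).

Lemma gauss_ge0 x : 0 <= gauss x. Proof. exact: expR_ge0. Qed.

Lemma gauss_le1 x : gauss x <= 1.
Proof. by rewrite expR_le1 oppr_le0 mulr_ge0. Qed.

Lemma gauss_subharmonic x : (k <= 2 * nrm x)%N -> gauss x <= avg gauss x.
Proof.
move=> kx.
have d0 : 0 < (2 * d)%:R :> R by rewrite ltr0n; lia.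
rewrite /avg mulrC ler_pdivlMr//.
have pair i : gauss x * (1 - rate) * (2 + rate ^+ 2 * (x ord0 i)%:~R ^+ 2) <=
    gauss (x + e_ i) + gauss (x - e_ i).
  set c := (x ord0 i)%:~R : R.
  have -> : gauss (x + e_ i) =
      gauss x * (expR (- rate) * expR (- (rate * (2 * c)))).
    by rewrite /gauss sqnormD -!expRD; congr expR; rewrite -/c; ring.
  have -> : gauss (x - e_ i) =
      gauss x * (expR (- rate) * expR (rate * (2 * c))).
    by rewrite /gauss sqnormB -!expRD; congr expR; rewrite -/c; ring.
  rewrite -!mulrDr -[leLHS]mulrA ler_wpM2l ?gauss_ge0//; apply: ler_pM.
  - by have := rate_le; lra.
  - by rewrite addr_ge0// mulr_ge0 ?sqr_ge0.
  - by have := expR_ge1Dx (- rate); lra.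
  - have := cosh_ge (rate * (2 * c)).
    rewrite [expR _ + _]addrC; apply: le_trans.
    by rewrite le_eqVlt; apply/orP; left; apply/eqP; field.
apply: le_trans; last by apply: ler_sum => i _; exact: pair.
rewrite -mulr_sumr -mulrA ler_wpM2l ?gauss_ge0//.
rewrite big_split/= sumr_const card_ord -mulr_sumr -sqnormE.
have q_ge : 4 * d%:R <= rate * (sqnorm x)%:R :> R.
  rewrite /rate mulrAC ler_pdivlMr ?exprn_gt0//.
  have : (k ^ 2 <= 4 * (d ^ 2 * sqnorm x))%N.
    apply: (@leq_trans ((2 * nrm x) ^ 2)); first by rewrite leq_exp2r.
    by rewrite expnMn leq_mul2l (sqnorm_gauge gauge).
  rewrite -(ler_nat R) natrX (natrM _ 4) (natrM _ (d ^ 2)) natrX => kq.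
  apply: le_trans (ler_wpM2l _ kq) _; first by rewrite mulr_ge0.
  by rewrite le_eqVlt; apply/orP; left; apply/eqP; ring.
rewrite -[2 *+ d]mulr_natl natrM expr2 -mulrA.
set Q := rate * _ in q_ge *; set D := d%:R : R in q_ge *.
have D0 : 0 < D by exact: dR0.
have := rate_ge0; have := rate_le; set r := rate => r1 r0.
have : r * (4 * D) <= r * Q by rewrite ler_wpM2l.
have : (1 - r) * (r * (4 * D)) <= (1 - r) * (r * Q).
  by rewrite ler_wpM2l ?ler_wpM2l//; lra.
have : 0 <= D * r * (1 - 2 * r) by rewrite mulr_ge0 ?mulr_ge0//; lra.
by lra.
Qed.

(** A lower bound for the Gaussian on the ball nrm x <= k, which does not depend
    on k: there |x|^2 <= d k ^ 2. *)
Definition well_floor : R := expR (- (16 * d%:R ^+ 4)).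

Lemma well_floor_gt0 : 0 < well_floor. Proof. exact: expR_gt0. Qed.

Lemma gauss_ge_floor x : (nrm x <= k)%N -> well_floor <= gauss x.
Proof.
move=> xk; rewrite /well_floor /gauss ler_expR lerN2.
have : (sqnorm x <= d * k ^ 2)%N.
  by apply: leq_trans (gauge_sqnorm gauge x) _; rewrite leq_mul2l leq_exp2r ?xk ?orbT.
rewrite -(ler_nat R) natrM natrX => xk2.
apply: le_trans (ler_wpM2l rate_ge0 xk2) _.
rewrite /rate le_eqVlt; apply/orP; left; apply/eqP; field.
by rewrite gt_eqF.
Qed.

(** On the sphere, [well] is the Gaussian and has a kink caused by the cone
    k - nrm x.  Inside, the maximum with a constant removes the region around
    the origin where the Gaussian is not subharmonic: there the cone, deeper
    than k / 2, has brought the first term below zero. *)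
Definition well (x : 'rV[int]_d) : R :=
  if (nrm x <= k)%N then
    Num.max (k%:R / 2 * gauss x - (k%:R - (nrm x)%:R)) (k%:R / 2 * well_floor)
  else k%:R / 2 * gauss x.

Let k2 : 0 < k%:R / 2 :> R. Proof. by rewrite divr_gt0. Qed.

Lemma well_floor_le1 : well_floor <= 1.
Proof. by rewrite expR_le1 oppr_le0 mulr_ge0// exprn_ge0. Qed.

Lemma well_outside x : (k <= nrm x)%N -> well x = k%:R / 2 * gauss x.
Proof.
rewrite /well leq_eqVlt => /orP[/eqP kx|]; last by rewrite ltnNge => /negPf ->.
rewrite -kx leqnn subrr subr0; apply/max_idPl.
by rewrite ler_pM2l// gauss_ge_floor// kx.
Qed.

Lemma well_inside x : (nrm x <= k)%N -> k%:R / 2 * well_floor <= well x.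
Proof. by move=> xk; rewrite /well xk le_max lexx orbT. Qed.

Lemma well_ge_cone x : (nrm x <= k)%N ->
  k%:R / 2 * gauss x - (k%:R - (nrm x)%:R) <= well x.
Proof. by move=> xk; rewrite /well xk le_max lexx. Qed.

(** A maximum is subharmonic wherever a term that attains it is, and the norm,
    being convex along each axis, only helps inside the ball.  On the sphere, the cone costs at most
    one for each step inwards. *)
Lemma well_subharmonic x : well x <= (nrm x == k)%:R + avg well x.
Proof.
have nbrD i := gauge_lipD gauge x i; have nbrB i := gauge_lipB gauge x i.
have backD i : (nrm x <= (nrm (x + e_ i)%R).+1)%N.
  by have := gauge_lipB gauge (x + e_ i) i; rewrite addrK.
have backB i : (nrm x <= (nrm (x - e_ i)%R).+1)%N.
  by have := gauge_lipD gauge (x - e_ i) i; rewrite subrK.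
have d0 : 0 < (2 * d)%:R :> R by rewrite ltr0n; lia.
have avgle (g h : 'rV[int]_d -> R) :
    (forall i, g (x + e_ i) + g (x - e_ i) <= h (x + e_ i) + h (x - e_ i)) ->
    avg g x <= avg h x.
  by move=> gh; rewrite /avg ler_pM2l ?invr_gt0//; apply: ler_sum.
have [xk|kx|xk] := ltngtP (nrm x) k; rewrite ?add0r.
- have yD i : (nrm (x + e_ i)%R <= k)%N by exact: leq_trans (nbrD i) xk.
  have yB i : (nrm (x - e_ i)%R <= k)%N by exact: leq_trans (nbrB i) xk.
  rewrite {1}/well (ltnW xk) ge_max; apply/andP; split; last first.
    rewrite -(avg_cst d_gt0 (k%:R / 2 * well_floor) x); apply: avgle => i.
    by rewrite lerD ?well_inside.
  have [cone_le|cone_gt] :=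
      leP (k%:R / 2 * gauss x - (k%:R - (nrm x)%:R)) (k%:R / 2 * well_floor).
    apply: le_trans cone_le _.
    rewrite -(avg_cst d_gt0 (k%:R / 2 * well_floor) x); apply: avgle => i.
    by rewrite lerD ?well_inside.
  (* The Gaussian is at most 1: if the cone term is positive then
     k - nrm x < k / 2. *)
  have x2 : (k <= 2 * nrm x)%N.
    rewrite -(ler_nat R) natrM.
    have := ler_wpM2l (ltW k2) (gauss_le1 x).
    have : 0 < k%:R / 2 * well_floor by rewrite mulr_gt0 ?well_floor_gt0.
    by lra.
  have subx := ler_wpM2l (ltW k2) (gauss_subharmonic x2).
  apply: (@le_trans _ _ (avg (fun y => k%:R / 2 * gauss y +
      - (k%:R - (nrm x)%:R)) x)).
    by rewrite avgD avgZ avg_cst// lerD2r.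
  apply: avgle => i.
  apply: le_trans (lerD (well_ge_cone (yD i)) (well_ge_cone (yB i))).
  have := gauge_convex gauge x i; rewrite -(ler_nat R) natrD -mul2n natrM.
  by lra.
- have subx : gauss x <= avg gauss x by apply: gauss_subharmonic; lia.
  have := ler_wpM2l (ltW k2) subx; rewrite -avgZ.
  rewrite well_outside ?(ltnW kx)// => /le_trans; apply.
  apply: avgle => i.
  by rewrite !well_outside// -ltnS ?(leq_trans kx).
- have subx : gauss x <= avg gauss x by apply: gauss_subharmonic; lia.
  have := ler_wpM2l (ltW k2) subx; rewrite -avgZ.
  rewrite well_outside ?xk// => /le_trans; apply.
  rewrite addrC -lerBlDr -(avg_cst d_gt0 (-1) x) -avgD.
  have drop y : (nrm y <= (nrm x).+1)%N -> (nrm x <= (nrm y).+1)%N ->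
      k%:R / 2 * gauss y + -1 <= well y.
    move=> y1 y2; have [yk|ky] := leqP (nrm y) k; last first.
      by rewrite well_outside ?(ltnW ky)//; lra.
    apply: le_trans (well_ge_cone yk).
    have : k%:R <= (nrm y)%:R + 1 :> R.
      by rewrite -[1]/(1%:R) -natrD ler_nat addn1 -xk.
    by lra.
  by apply: avgle => i; rewrite lerD// drop.
Qed.

Lemma well_le x : well x <= k%:R / 2.
Proof.
rewrite /well; case: ifP => xk; last first.
  by rewrite ler_piMr ?gauss_le1 ?ltW.
rewrite ge_max; apply/andP; split; last first.
  by rewrite ler_piMr ?well_floor_le1 ?ltW.
have := ler_wpM2l (ltW k2) (gauss_le1 x).
have : (nrm x)%:R <= k%:R :> R by rewrite ler_nat.
by lra.
Qed.

Lemma well_vanishes : exists B : nat, forall x,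
  well x <= k%:R / 2 * (nrm x <= B)%N%:R + k%:R / 2 * (well_floor / 4).
Proof.
have w0 := well_floor_gt0.
set t := k%:R ^+ 2 * 4 / well_floor.
have t0 : 0 <= t by rewrite divr_ge0 ?(ltW w0)// mulr_ge0 ?sqr_ge0.
exists (maxn k (Num.bound t)) => x.
have [xB|Bx] := leqP (nrm x) (maxn k (Num.bound t)).
  rewrite mulr1 (le_trans (well_le x))// lerDl.
  by apply/ltW/mulr_gt0 => //; apply: divr_gt0.
rewrite mulr0n mulr0 add0r.
have /andP[kx tx] : (k < nrm x)%N && (Num.bound t < nrm x)%N by rewrite -gtn_max.
rewrite well_outside ?(ltnW kx)// ler_pM2l//.
have ge1 : t < (nrm x)%:R.
  by apply: lt_trans (archi_boundP t0) _; rewrite ltr_nat.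
have s_ge : (nrm x)%:R / k%:R ^+ 2 <= rate * (sqnorm x)%:R.
  rewrite /rate [leRHS]mulrAC ler_wpM2r ?invr_ge0 ?sqr_ge0//.
  have h1 : (nrm x <= 16 * d * (d ^ 2 * sqnorm x))%N.
    apply: leq_trans (leq_mul (_ : 1 <= 16 * d)%N (sqnorm_gauge gauge x)).
      by rewrite mul1n; case: (nrm x) => // n; rewrite expnS leq_pmulr// expn_gt0.
    by lia.
  have -> : 16 * d%:R ^+ 3 * (sqnorm x)%:R = (16 * d * (d ^ 2 * sqnorm x))%:R :> R.
    by rewrite !(natrM, natrX); ring.
  by rewrite ler_nat.
have q : 4 / well_floor <= rate * (sqnorm x)%:R.
  apply: le_trans s_ge; rewrite ler_pdivlMr ?exprn_gt0//.
  have -> : 4 / well_floor * k%:R ^+ 2 = t by rewrite /t; ring.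
  exact: ltW.
rewrite /gauss expRN -[leRHS]invrK lef_pV2 ?posrE ?expR_gt0 ?invr_gt0 ?divr_gt0//.
rewrite invf_div; apply: le_trans q _.
by have := expR_ge1Dx (rate * (sqnorm x)%:R); lra.
Qed.

End gaussian.

(** The function [well] is at least of order k inside the sphere, and most
    terminal values E [well (S_n)] are much smaller, because the walk spends
    a bounded expected time in any ball.  Averaging over the terminal time n
    makes the number of steps independent of the starting point, since the
    bound on the time spent in a ball is. *)
Lemma occ_sphere_ge (nrm : 'rV[int]_d -> nat) : lattice_gauge nrm ->
  exists2 c : R, 0 < c & exists K0 : nat, forall k, (K0 <= k)%N ->
    exists N, forall y, (nrm y <= k)%N ->
      c * k%:R <= occ N (fun z => (nrm z == k)%:R) y.
Proof.
move=> gauge; have w0 := well_floor_gt0.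
exists (well_floor / 4); first by rewrite divr_gt0.
exists (32 * d ^ 3)%N => k hk.
have k0 : (0 < k)%N.
  by apply: leq_trans hk; rewrite muln_gt0 expn_gt0 d_gt0.
have kl : (32 * d ^ 3 <= k ^ 2)%N.
  by apply: leq_trans hk _; rewrite leq_pmulr.
have kR : 0 < k%:R / 2 :> R by rewrite divr_gt0// ltr0n.
have [B hB] := well_vanishes gauge kl.
have [C C0 hC] := @occ_sphere_le R d d_ge3 nrm gauge.
set ball := fun z => (nrm z <= B)%N%:R : R.
pose CB : R := \sum_(0 <= j < B.+1) C * j.+1%:R.
have occB N y : occ N ball y <= CB.
  rewrite (_ : ball = fun z => \sum_(0 <= j < B.+1) (nrm z == j)%:R).
    by rewrite occ_sum; apply: ler_sum => j _; exact: hC.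
  apply/funext => z; rewrite /ball -natr_sum; congr _%:R.
  rewrite big_mkord; have [zB|Bz] := leqP (nrm z) B.
    rewrite (bigD1 (Ordinal (zB : (nrm z < B.+1)%N)))//= eqxx big1// => j ji.
    by apply/eqP; rewrite eqb0 eq_sym; apply: contraNneq ji => jz; apply/eqP/val_inj.
  rewrite big1// => j _; apply/eqP; rewrite eqb0 neq_ltn.
  by apply/orP; right; exact: leq_trans (ltn_ord j) Bz.
have CB0 : 0 <= CB * 4 / well_floor.
  rewrite divr_ge0 ?(ltW w0)// mulr_ge0// sumr_ge0// => j _.
  by rewrite mulr_ge0// ltW.
pose N := (Num.bound (CB * 4 / well_floor)).+1.
exists N => y yk.
set O := occ N _ y.
have term n : (n < N)%N -> well nrm k y <=
    O + (k%:R / 2 * iter n avg ball y + k%:R / 2 * (well_floor / 4)).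
  move=> nN.
  apply: le_trans (occ_ge_subharmonic (well_subharmonic gauge kl) n y) _.
  apply: lerD; first by apply: occ_mono; rewrite ?(ltnW nN).
  apply: le_trans (iter_avg_le n y hB) _.
  by rewrite iter_avgD iter_avgZ iter_avg_cst.
have NS : N%:R * well nrm k y <= N%:R * O +
    (k%:R / 2 * occ N ball y + N%:R * (k%:R / 2 * (well_floor / 4))).
  have : \sum_(0 <= n < N) well nrm k y <= \sum_(0 <= n < N)
      (O + (k%:R / 2 * iter n avg ball y + k%:R / 2 * (well_floor / 4))).
    by apply: ler_sum_nat => n /andP[_ nN]; exact: term.
  rewrite !big_split/= -mulr_sumr -/(occ N ball y).
  rewrite !sumr_const_nat subn0 -(mulr_natl (well nrm k y)) -(mulr_natl O).
  by rewrite -(mulr_natl (k%:R / 2 * (well_floor / 4))).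
have N0 : 0 < N%:R :> R by rewrite ltr0n.
have NCB : CB <= N%:R * (well_floor / 4).
  have : CB * 4 / well_floor <= N%:R.
    by apply: le_trans (ltW (archi_boundP CB0)) _; rewrite ler_nat.
  by rewrite ler_pdivrMr//; lra.
have wy := well_inside yk.
rewrite -(ler_pM2l N0).
have h1 : k%:R / 2 * occ N ball y <= k%:R / 2 * (N%:R * (well_floor / 4)).
  by rewrite ler_pM2l// (le_trans (occB N y)).
have h2 := ler_wpM2l (ltW N0) wy.
by lra.
Qed.

End occupation_lower.

(** * Finite paths, the second moment method, and restarting *)

Section paths.
Context {R : realType} {d : nat}.
Implicit Types (F : 'rV[int]_d -> R) (Phi Psi : seq 'rV[int]_d -> R).

(** The expectation of Phi (S_1, ..., S_N) for the walk started from x. *)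
Fixpoint pexp N (x : 'rV[int]_d) Phi : R :=
  if N is N'.+1 then avg (fun y => pexp N' y (fun s => Phi (y :: s))) x
  else Phi [::].

Lemma pexp_le N x Phi Psi : (forall s, Phi s <= Psi s) ->
  pexp N x Phi <= pexp N x Psi.
Proof.
elim: N x Phi Psi => [|N IH] x Phi Psi le_PP /=; first exact: le_PP.
by apply: avg_le => y; apply: IH => s.
Qed.

Lemma eq_pexp N x Phi Psi : Phi =1 Psi -> pexp N x Phi = pexp N x Psi.
Proof. by move=> PP; congr pexp; apply/funext. Qed.

Lemma pexpD N x Phi Psi :
  pexp N x (fun s => Phi s + Psi s) = pexp N x Phi + pexp N x Psi.
Proof.
elim: N x Phi Psi => [//|N IH] x Phi Psi /=.
by rewrite -avgD; apply: eq_avg => y; rewrite IH.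
Qed.

Lemma pexpZ N x (a : R) Phi : pexp N x (fun s => a * Phi s) = a * pexp N x Phi.
Proof.
elim: N x Phi => [//|N IH] x Phi /=.
by rewrite -avgZ; apply: eq_avg => y; rewrite IH.
Qed.

Hypothesis d_gt0 : (0 < d)%N.

Lemma pexp_cst N x (a : R) : pexp N x (fun=> a) = a.
Proof.
elim: N x => [//|N IH] x /=.
by rewrite -[RHS](avg_cst d_gt0 a x); apply: eq_avg.
Qed.

Lemma pexp_ge0 N x Phi : (forall s, 0 <= Phi s) -> 0 <= pexp N x Phi.
Proof. by move=> P0; rewrite -[leLHS](pexp_cst N x 0); apply: pexp_le. Qed.

Lemma pexp_sum N x F :
  pexp N x (fun s => \sum_(y <- s) F y) = avg (occ N F) x.
Proof.
elim: N x => [|N IH] x /=.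
  by rewrite big_nil -[LHS](avg_cst d_gt0 0 x); apply: eq_avg => y; rewrite occ0.
apply: eq_avg => y; rewrite occS -IH -[F y in RHS](pexp_cst N y) -pexpD.
by apply: eq_pexp => s; rewrite big_cons.
Qed.

(** In E (sum_i F (S_i)) ^ 2 <= 2 E sum_i F (S_i) sum_(j >= i) F (S_j), the inner
    sum has conditional expectation at most B by the Markov property. *)
Lemma pexp_sum_sqr F (B : R) : (forall y, 0 <= F y) ->
  (forall N y, occ N F y <= B) -> forall N x,
  pexp N x (fun s => (\sum_(y <- s) F y) ^+ 2) <=
  2 * B * pexp N x (fun s => \sum_(y <- s) F y).
Proof.
move=> F0 FB; elim=> [|N IH] x /=; first by rewrite !big_nil expr0n mulr0.
rewrite -avgZ; apply: avg_le => y.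
set m1 := pexp N y (fun s => \sum_(z <- s) F z).
have -> : pexp N y (fun s => \sum_(z <- y :: s) F z) = F y + m1.
  rewrite -[F y in RHS](pexp_cst N y) -pexpD.
  by apply: eq_pexp => s; rewrite big_cons.
have -> : pexp N y (fun s => (\sum_(z <- y :: s) F z) ^+ 2) =
    F y ^+ 2 + (2 * F y * m1 + pexp N y (fun s => (\sum_(z <- s) F z) ^+ 2)).
  rewrite -[F y ^+ 2](pexp_cst N y) -pexpZ -!pexpD.
  by apply: eq_pexp => s; rewrite big_cons sqrrD; ring.
have := FB N.+1 y; rewrite occS -pexp_sum -/m1 => m1B.
have m10 : 0 <= m1.
  by apply: pexp_ge0 => s; apply: sumr_ge0.
have := IH y; rewrite -/m1.
have := F0 y => Fy; have := ler_wpM2l Fy m1B.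
have := mulr_ge0 Fy m10; have := mulr_ge0 Fy Fy.
by nra.
Qed.

(** Pointwise, the indicator of X < M is at most
    1 - 2 tau (X - M) + tau ^ 2 X ^ 2 = (1 - tau X) ^ 2 + 2 tau M.  Keeping tau
    free makes the inequality linear in the moments of X. *)
Lemma second_moment_method N x F (M tau : R) : 0 <= M -> 0 <= tau ->
  pexp N x (fun s => (\sum_(y <- s) F y < M)%R%:R) <=
  1 - 2 * tau * (pexp N x (fun s => \sum_(y <- s) F y) - M)
    + tau ^+ 2 * pexp N x (fun s => (\sum_(y <- s) F y) ^+ 2).
Proof.
move=> M0 tau0.
set P1 := pexp _ _ (fun s => \sum_(y <- s) F y).
have -> : 1 - 2 * tau * (P1 - M) + tau ^+ 2 *
      pexp N x (fun s => (\sum_(y <- s) F y) ^+ 2) =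
    pexp N x (fun s => (1 + 2 * tau * M) + ((- (2 * tau)) * (\sum_(y <- s) F y)
      + tau ^+ 2 * (\sum_(y <- s) F y) ^+ 2)).
  by rewrite !(pexpD, pexpZ, pexp_cst) -/P1; ring.
apply: pexp_le => s; set X := \sum_(y <- s) F y.
have tM : 0 <= tau * M by rewrite mulr_ge0.
have [XM|MX] := ltP X M.
  have : tau * X <= tau * M by rewrite ler_wpM2l// ltW.
  have := sqr_ge0 (tau * X); rewrite exprMn mulr1n.
  by lra.
by have := sqr_ge0 (1 - tau * X); rewrite mulr0n sqrrB exprMn; lra.
Qed.

Definition prob_below F N x M :=
  pexp N x (fun s => (\sum_(y <- s) F y < M)%R%:R).

Lemma prob_belowS F N x M :
  prob_below F N.+1 x M = avg (fun y => prob_below F N y (M - F y)) x.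
Proof.
apply: eq_avg => y; apply: eq_pexp => s.
by rewrite big_cons ltrBrDl.
Qed.

Lemma prob_below_le1 F N x M : prob_below F N x M <= 1.
Proof.
rewrite -[leRHS](pexp_cst N x 1); apply: pexp_le => s.
by case: (_ < _).
Qed.

Lemma prob_below_mono F N x M1 M2 : M1 <= M2 ->
  prob_below F N x M1 <= prob_below F N x M2.
Proof.
move=> M12; apply: pexp_le => s; rewrite ler_nat.
by case: ltP => // s1; rewrite (lt_le_trans s1 M12).
Qed.

Lemma prob_below_antimono F G N x M : (forall y, F y <= G y) ->
  prob_below G N x M <= prob_below F N x M.
Proof.
move=> FG; apply: pexp_le => s; rewrite ler_nat.
case: ltP => // s1; rewrite (le_lt_trans _ s1)//; exact: ler_sum.
Qed.

(** Markov property at time N1: on the event that M has not been reached by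
    then, it still has to be missed by the next N2 steps, whose starting point
    has norm at most nrm x + N1. *)
Lemma prob_below_restart (nrm : 'rV[int]_d -> nat) F N2 (q M : R) :
  lattice_gauge nrm -> (forall y, 0 <= F y) -> 0 <= q -> forall N1 x,
  (forall y, (nrm y <= nrm x + N1)%N -> prob_below F N2 y M <= q) ->
  prob_below F (N1 + N2) x M <= q * prob_below F N1 x M.
Proof.
move=> gauge F0 q0 N1; elim: N1 M => [|N1 IH] M x hq.
  rewrite /prob_below /= big_nil add0n; have [M0|M0] := ltP 0 M.
    by rewrite mulr1 hq// addn0.
  rewrite mulr0 -[leRHS](pexp_cst N2 x); apply: pexp_le => s.
  by rewrite ltNge (le_trans M0)// sumr_ge0.
rewrite addSn !prob_belowS -avgZ.
have step y : (nrm y <= (nrm x).+1)%N ->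
    prob_below F (N1 + N2) y (M - F y) <= q * prob_below F N1 y (M - F y).
  move=> yx; apply: IH => z zy.
  apply: le_trans (prob_below_mono _ _ _ (_ : M - F y <= M)) _; first by rewrite gerBl.
  by apply: hq; rewrite (leq_trans zy)// addnS -addSn leq_add2r.
apply: avg_le_step => i; apply: step.
  by apply: gauge_lipD.
by apply: gauge_lipB.
Qed.

End paths.

Section divergence.
Context {R : realType} {d : nat}.
Hypothesis d_ge3 : (3 <= d)%N.
Variables (nrm : 'rV[int]_d -> nat) (gauge : lattice_gauge nrm).

Let d_gt0 : (0 < d)%N. Proof. lia. Qed.

(** The spheres k0 <= k < k1 carry a mass a = sum k f k that may be chosen as
    large as needed, with k0 beyond the starting points.  The sum over this
    block has expectation between c a and 2 C a, and second moment at most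
    8 C ^ 2 a ^ 2, whatever the start: the probability of exceeding c a / 2 >= M is
    at least a constant that depends on c / C only. *)
Lemma prob_below_uniform : exists2 q : R, 0 <= q < 1 &
  forall f : nat -> R, (forall k, 0 <= f k) ->
  (forall A, exists n, A <= \sum_(0 <= k < n) k%:R * f k) ->
  forall M r, exists N, forall y, (nrm y <= r)%N -> prob_below (f \o nrm) N y M <= q.
Proof.
have [C C0 upper] := @occ_sphere_le R d d_ge3 nrm gauge.
have [c c0 [K0 lower]] := @occ_sphere_ge R d d_ge3 nrm gauge.
pose p := c ^+ 2 / (32 * C ^+ 2).
have p0 : 0 < p by rewrite divr_gt0 ?mulr_gt0 ?exprn_gt0.
exists (Num.max 0 (1 - p)).
  by rewrite le_max lexx/= gt_max ltr01/=; lra.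
move=> f f0 div M r.
have {}lower : forall k, exists N, (K0 <= k)%N -> forall y, (nrm y <= k)%N ->
    c * k%:R <= occ N (fun z => (nrm z == k)%:R) y.
  move=> k; have [K0k|kK0] := leqP K0 k; last by exists 0%N.
  by have [N hN] := lower k K0k; exists N.
have [Nf {}lower] := choice lower.
pose k0 := maxn K0 r.+1.
pose A := Num.max (2 * M / c) 1.
have [k1 hk1] := div (\sum_(0 <= k < k0) k%:R * f k + A).
have A1 : 1 <= A by rewrite le_max lexx orbT.
have term_ge0 k : 0 <= k%:R * f k by rewrite mulr_ge0.
have k01 : (k0 <= k1)%N.
  rewrite leqNgt; apply/negP => k10.
  have : \sum_(0 <= k < k1) k%:R * f k <= \sum_(0 <= k < k0) k%:R * f k.
    by rewrite [leRHS](big_cat_nat _ (ltnW k10))//= lerDl sumr_ge0.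
  by lra.
pose a := \sum_(k0 <= k < k1) k%:R * f k.
have aA : A <= a.
  by move: hk1; rewrite (big_cat_nat _ k01)//= lerD2l.
have a0 : 0 < a by lra.
pose F y := \sum_(k0 <= k < k1) f k * (nrm y == k)%:R.
have F0 y : 0 <= F y by apply: sumr_ge0 => k _; rewrite mulr_ge0.
have Ff y : F y <= (f \o nrm) y.
  rewrite /F /=; have [yk|yk] := boolP (nrm y \in index_iota k0 k1).
    rewrite (bigD1_seq (nrm y)) ?iota_uniq//= eqxx mulr1 big1 ?addr0// => k ky.
    by rewrite eq_sym (negPf ky) mulr0.
  rewrite big1_seq// => k /andP[_ ki]; have [ky|] := eqVneq (nrm y) k.
    by rewrite ky ki in yk.
  by rewrite mulr0.
have occFE N y : occ N F y =
    \sum_(k0 <= k < k1) f k * occ N (fun z => (nrm z == k)%:R) y.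
  by rewrite /F occ_sum; apply: eq_bigr => k _; rewrite occZ.
pose B := 2 * C * a.
have occB N y : occ N F y <= B.
  rewrite occFE /B /a mulr_sumr; apply: ler_sum_nat => k /andP[k0k _].
  apply: le_trans (ler_wpM2l (f0 k) (upper k N y)) _.
  have k1R : 1 <= k%:R :> R.
    by rewrite ler1n; apply: leq_trans k0k; rewrite /k0 leq_max orbT.
  have : 0 <= f k * C * (k%:R - 1) by rewrite !mulr_ge0 ?subr_ge0// ltW.
  by rewrite -natr1; lra.
pose N := (\sum_(k0 <= k < k1) Nf k)%N.
exists N => y yr.
have yk0 : (nrm y < k0)%N by rewrite /k0 leq_max ltnS yr orbT.
have Fy : F y = 0.
  rewrite /F big_nat big1// => k /andP[k0k _].
  by rewrite (_ : nrm y == k = false) ?mulr0//; lia.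
set m1 := pexp N y (fun s => \sum_(z <- s) F z).
have m1_ge : c * a <= m1.
  rewrite /m1 pexp_sum// (_ : avg _ y = occ N.+1 F y) ?occS ?Fy ?add0r//.
  rewrite -[avg _ y]add0r -[in leRHS]Fy -occS occFE /a mulr_sumr.
  apply: ler_sum_nat => k kk; have /andP[k0k kk1] := kk.
  rewrite mulrA [leLHS]mulrC ler_wpM2l//.
  apply: le_trans (lower k _ y _) _.
  - by apply: leq_trans k0k; rewrite leq_maxl.
  - by lia.
  apply: occ_mono => //; apply: leqW; rewrite /N (bigD1_seq k) ?iota_uniq//=.
    by rewrite leq_addr.
  by rewrite mem_index_iota.
have m1B : m1 <= B.
  by rewrite /m1 pexp_sum//; apply: avg_lecst.
(* This tau minimizes 1 - tau (c a) + 8 (tau C a) ^ 2, with minimum 1 - p. *)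
pose tau := c / (16 * C ^+ 2 * a).
have M1_ge : M <= c * a / 2.
  have : 2 * M / c <= a by apply: le_trans aA; rewrite le_max lexx.
  by rewrite ler_pdivrMr//; lra.
apply: le_trans (prob_below_mono _ _ _ M1_ge) _.
apply: le_trans (prob_below_antimono _ _ _ Ff) _.
have tau0 : 0 <= tau by rewrite divr_ge0 ?mulr_ge0 ?sqr_ge0// ltW.
have M10 : 0 <= c * a / 2 by rewrite divr_ge0// mulr_ge0// ltW.
apply: le_trans (second_moment_method d_gt0 N y F M10 tau0) _.
rewrite le_max; apply/orP; right.
have m2 := pexp_sum_sqr d_gt0 F0 occB N y.
rewrite -/m1 in m2 *.
have B0 : 0 <= B by rewrite !mulr_ge0// ltW.
have {}m2 := le_trans m2 (ler_wpM2l (mulr_ge0 (ler0n _ 2) B0) m1B).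
have t1 : tau * (c * a) <= tau * m1 by rewrite ler_wpM2l.
have t2 := ler_wpM2l (sqr_ge0 tau) m2.
have e1 : tau * (c * a) = 2 * p.
  by rewrite /tau /p; field; rewrite !gt_eqF.
have e2 : tau ^+ 2 * (2 * B * B) = p.
  by rewrite /tau /p /B; field; rewrite !gt_eqF.
by lra.
Qed.

Lemma prob_below_cvg0 (f : nat -> R) : (forall k, 0 <= f k) ->
  (forall A, exists n, A <= \sum_(0 <= k < n) k%:R * f k) ->
  forall x M (eps : R), 0 < eps -> exists N, prob_below (f \o nrm) N x M <= eps.
Proof.
move=> f0 div x M eps eps0; have [q /andP[q0 q1] block] := prob_below_uniform.
have pow j : exists N, prob_below (f \o nrm) N x M <= q ^+ j.
  elim: j => [|j [N1 IH]]; first by exists 0%N; rewrite expr0 prob_below_le1.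
  have [N2 hN2] := block f f0 div M (nrm x + N1)%N.
  exists (N1 + N2)%N; apply: le_trans (prob_below_restart d_gt0 gauge _ q0 hN2) _ => //=.
  by rewrite exprS ler_wpM2l.
have [j qj] : exists j, q ^+ j <= eps.
  have := cvg_expr (_ : `|q| < 1); rewrite ger0_norm// => /(_ q1).
  move=> /cvgr0_norm_le /(_ _ eps0) [j _ /(_ j (leqnn j))]/=.
  by rewrite ger0_norm ?exprn_ge0//; exists j.
by have [N hN] := pow j; exists N; exact: le_trans qj.
Qed.

End divergence.

(** * The law of the first steps of the walk *)

Section law.
Context {R : realType} {dT : measure_display} {T : measurableType dT}.
Context {P : probability T R} {d : nat}.
Hypothesis d_gt0 : (0 < d)%N.
Variable S : nat -> {RV P >-> 'rV[int]_d}.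
Hypothesis S_srw : simple_random_walk S.

(** The states form a countable set, so that any condition on finitely many of
    them cuts out a countable union of measurable sets. *)
Lemma measurable_trajectory (l : seq nat) (B : set (seq 'rV[int]_d)) :
  measurable [set t | B [seq S n t | n <- l]].
Proof.
have -> : [set t | B [seq S n t | n <- l]] =
    \bigcup_(s : seq 'rV[int]_d)
      (if `[< B s >] then [set t | [seq S n t | n <- l] = s] else set0).
  apply/seteqP; split => [t Bt|t [s _]].
    by exists [seq S n t | n <- l] => //; case: asboolP.
  by case: asboolP => // Bs /= ->.
apply: countable_bigcupT_measurable; first exact: countableP.
move=> s; case: ifP => // _; elim: l s => [|n l IH] [|x s] /=.
- by rewrite (_ : [set _ | _] = setT)//; apply/seteqP.
- by rewrite (_ : [set _ | _] = set0)//; apply/seteqP; split.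
- by rewrite (_ : [set _ | _] = set0)//; apply/seteqP; split.
- rewrite (_ : [set _ | _] =
      S n @^-1` [set x] `&` [set t | [seq S n t | n <- l] = s]); last first.
    by apply/seteqP; split => t /= [-> ->].
  apply: measurableI => //.
  by rewrite -[X in measurable X]setTI; exact: measurable_funP.
Qed.

Definition increment n t := S n.+1 t - S n t.

Lemma measurable_increment n (A : set 'rV[int]_d) :
  measurable (increment n @^-1` A).
Proof.
exact: (@measurable_trajectory [:: n; n.+1]
  [set s | A (nth 0 s 1 - nth 0 s 0)]).
Qed.

Definition cylinder (w : seq 'rV[int]_d) : set T :=
  [set t | forall j, (j < size w)%N -> increment j t = w`_j].

Lemma walk_on_cylinder w t : cylinder w t -> S (size w) t = \sum_(v <- w) v.
Proof.
elim/last_ind: w => [_|w v IH cyl]; first by rewrite big_nil srw_start.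
have tw : cylinder w t.
  move=> j jw; have := cyl j; rewrite size_rcons ltnS (ltnW jw) nth_rcons jw.
  exact.
have := cyl (size w); rewrite size_rcons ltnS leqnn nth_rcons ltnn eqxx.
move=> /(_ isT) /eqP; rewrite subr_eq IH// => /eqP ->.
by rewrite -cats1 big_cat/= big_seq1 addrC.
Qed.

Lemma cylinderP w : P (cylinder w) =
  (\prod_(0 <= j < size w) P [set t | increment j t = w`_j])%E.
Proof.
pose J := [fset j in iota 0 (size w)]%fset.
have JE j : (j \in J) = (j < size w)%N by rewrite in_fset mem_iota.
have := @srw_independent _ _ _ _ _ _ S_srw J (fun j => [set w`_j]).
rewrite (_ : \bigcap_(j in _) _ = cylinder w); last first.
  by apply/seteqP; split => t /= h j; have := h j; rewrite /= JE.
move=> -> //; rewrite /index_iota subn0; apply: perm_big.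
by rewrite uniq_perm ?iota_uniq// => j; rewrite JE mem_iota.
Qed.

Lemma cylinder_rcons w v : P (cylinder (rcons w v)) =
  (P (cylinder w) * P [set t | increment (size w) t = v])%E.
Proof.
rewrite !cylinderP size_rcons big_nat_recr//= nth_rcons ltnn eqxx.
congr (_ * _)%E; by apply: eq_big_nat => j /andP[_ jw]; rewrite nth_rcons jw.
Qed.

Definition step (p : 'I_d * bool) : 'rV[int]_d := if p.2 then e_ p.1 else - e_ p.1.

Lemma step_inj : injective step.
Proof.
move=> [i b] [j c]; rewrite /step /= => h.
have hi := congr1 (fun x : 'rV[int]_d => x ord0 i) h.
have hj := congr1 (fun x : 'rV[int]_d => x ord0 j) h.
by move: hi hj; case: b {h}; case: c; rewrite !mxE !eqxx /= [j == i]eq_sym;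
  case: eqVneq => [->|] //=.
Qed.

Lemma prob_step n p : P [set t | increment n t = step p] = ((2 * d)%:R^-1)%:E.
Proof.
rewrite (srw_uniform S_srw) indicE mem_set ?div1r//.
by exists p.1; rewrite /step; case: p.2; [left|right].
Qed.

(** The 2d possible values of an increment are distinct and their
    probabilities add up to one. *)
Lemma prob_split_step n (A : set T) : measurable A ->
  P A = (\sum_p P (A `&` [set t | increment n t = step p]))%E.
Proof.
move=> mA; set D := \bigcup_(p in setT) [set t | increment n t = step p].
have mE p : measurable [set t | increment n t = step p].
  exact: (measurable_increment n [set step p]).
have mD : measurable D by apply: fin_bigcup_measurable.
have tE (B : set T) : trivIset setT (fun p => B `&` [set t | increment n t = step p]).
  move=> p q _ _ [t [[_ /= tp] [_ /= tq]]].
  by apply: step_inj; rewrite -tp -tq.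
have sumE (B : set T) : measurable B ->
    P (B `&` D) = (\sum_p P (B `&` [set t | increment n t = step p]))%E.
  move=> mB; rewrite /D setI_bigcupr.
  have fin : finite_set [set: 'I_d * bool] by exact: finite_finset.
  have mBE p : [set: 'I_d * bool] p ->
      measurable (B `&` [set t | increment n t = step p]).
    by move=> _; apply: measurableI.
  rewrite (measure_fin_bigcup P fin (tE B) mBE).
  rewrite (fsbigE (index_enum _)) ?index_enum_uniq//.
    by apply: eq_bigl => p; rewrite in_setT.
  by move=> p _; rewrite mem_index_enum.
have PD : P D = 1%E.
  rewrite -[D]setTI sumE// (eq_bigr (fun=> ((2 * d)%:R^-1)%:E)).
    rewrite sumEFin sumr_const card_prod card_ord card_bool mulnC.
    by rewrite -[_ *+ _]mulr_natr mulVf// pnatr_eq0; lia.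
  by move=> p _; rewrite setTI prob_step.
have AD0 : P (A `\` D) = 0%E.
  apply/eqP; rewrite eq_le measure_ge0 andbT.
  apply: (@le_trans _ _ (P (~` D))).
    apply: le_measure; rewrite ?inE; last by move=> t [].
      exact: measurableD.
    exact: measurableC.
  by rewrite probability_setC// PD subee.
rewrite -sumE// -[RHS]add0e -[in RHS]AD0.
exact: (measureDI P mA mD).
Qed.

(** Markov property in the form that an induction on N can prove: the past
    enters as a prescribed list w of increments, and determines the state from
    which the N further steps start. *)
Lemma path_law (Q : seq 'rV[int]_d -> bool) N w :
  P (cylinder w `&` [set t | Q [seq S n t | n <- iota (size w).+1 N]]) =
  (P (cylinder w) * (pexp N (\sum_(v <- w) v) (fun s => (Q s)%:R))%:E)%E.
Proof.
have mC u : measurable (cylinder u).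
  rewrite (_ : cylinder u = \bigcap_(j in `I_(size u)) (increment j @^-1` [set u`_j])).
    by apply: bigcap_measurableType => j _; exact: measurable_increment.
  by apply/seteqP; split.
elim: N Q w => [|N IH] Q w /=.
  have [Qn|Qn] := boolP (Q [::]).
    by rewrite mule1 (_ : [set _ | _] = setT) ?setIT//; apply/seteqP.
  by rewrite mule0 (_ : [set _ | _] = set0) ?setI0//; apply/seteqP; split.
set A := cylinder w `&` _.
have mA : measurable A.
  apply: measurableI => //.
  exact: (measurable_trajectory (iota (size w).+1 N.+1) [set s | Q s]).
rewrite (prob_split_step (size w) mA).
have split p : P (A `&` [set t | increment (size w) t = step p]) =
    (P (cylinder w) * ((2 * d)%:R^-1 * pexp N (\sum_(v <- w) v + step p)
      (fun s => (Q ((\sum_(v <- w) v + step p) :: s))%:R))%:E)%E.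
  set v := step p; set x := \sum_(v <- w) v.
  have xv : \sum_(v <- rcons w v) v = x + v by rewrite -cats1 big_cat/= big_seq1.
  have := IH (fun s => Q ((x + v) :: s)) (rcons w v).
  rewrite cylinder_rcons prob_step xv -muleA -EFinM => <-.
  congr (P _); apply/seteqP; split => t.
    move=> [[cw Qt] /= tv].
    have crw : cylinder (rcons w v) t.
      move=> j; rewrite size_rcons ltnS leq_eqVlt nth_rcons => /orP[/eqP ->|jw].
        by rewrite ltnn eqxx.
      by rewrite jw cw.
    split => //=; have := walk_on_cylinder crw; rewrite size_rcons xv => <-.
    exact: Qt.
  rewrite size_rcons => -[crw /= Qt].
  have cw : cylinder w t.
    by move=> j jw; have := crw j; rewrite size_rcons ltnS (ltnW jw) nth_rcons jw; apply.
  have tv : increment (size w) t = v.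
    by have := crw (size w); rewrite size_rcons ltnS leqnn nth_rcons ltnn eqxx; apply.
  split => //; split => //=; have := walk_on_cylinder crw.
  by rewrite size_rcons xv => ->.
rewrite (eq_bigr _ (fun p _ => split p)) -ge0_sume_distrr; last first.
  by move=> p _; rewrite lee_fin mulr_ge0// pexp_ge0.
congr (_ * _)%E; rewrite sumEFin; congr _%:E.
rewrite -mulr_sumr /avg; congr (_ * _).
pose G y := pexp N y (fun s => (Q (y :: s))%:R) : R.
rewrite (eq_bigr (fun p => G (\sum_(v <- w) v + step (p.1, p.2)))); last by case.
rewrite -(pair_bigA _ (fun i b => G (\sum_(v <- w) v + step (i, b))))/=.
by apply: eq_bigr => i _; rewrite big_bool.
Qed.

Lemma path_law0 (Q : seq 'rV[int]_d -> bool) N :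
  P [set t | Q [seq S n t | n <- iota 1 N]] =
  (pexp N 0 (fun s => (Q s)%:R))%:E.
Proof.
have := path_law Q N [::]; rewrite big_nil /=.
have -> : cylinder [::] = setT by apply/seteqP; split.
by rewrite setTI probability_setT mul1e.
Qed.

End law.

(** * Additive functionals of the walk *)

Section series.
Context {R : realType}.
Local Open Scope ereal_scope.

Lemma nneseries_le_bound (u : nat -> \bar R) (m : nat) (M : \bar R) :
  (forall n, 0 <= u n) -> (forall N, \sum_(m <= n < N) u n <= M) ->
  \sum_(m <= n <oo) u n <= M.
Proof.
move=> u0 uM; apply: lime_le; first by apply: is_cvg_nneseries => n _ _.
by apply: nearW.
Qed.

Lemma nneseries_pred1 (a : nat -> R) m : (forall k, 0 <= a k)%R ->
  \sum_(k <oo) (a k * (m == k)%:R)%:E = (a m)%:E.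
Proof.
move=> a0.
have t0 k : 0 <= (a k * (m == k)%:R)%:E by rewrite lee_fin mulr_ge0.
rewrite (nneseries_split 0 m.+1)// add0n big_mkord (bigD1 ord_max)//= eqxx mulr1.
rewrite big1 ?adde0; last first.
  move=> i im; rewrite (_ : m == i = false) ?mulr0//.
  by apply/eqP => mi; move/eqP: im; apply; apply/val_inj.
rewrite eseries0 ?adde0// => k mk _.
by rewrite (_ : m == k = false) ?mulr0//; apply/eqP => mi; lia.
Qed.

Lemma nneseries_unbounded (a : nat -> R) : (forall k, 0 <= a k)%R ->
  ~ (\sum_(1 <= k <oo) (a k)%:E < +oo) ->
  forall A : R, exists n, (A <= \sum_(0 <= k < n) a k)%R.
Proof.
move=> a0 div A; apply/not_existsP => bounded; apply: div.
apply: (@le_lt_trans _ _ A%:E); last exact: ltry.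
apply: nneseries_le_bound => [k|n]; first by rewrite lee_fin.
rewrite sumEFin lee_fin; have [n0|n1] := posnP n.
  rewrite n0 big_geq//; have := bounded 0%N; rewrite big_nil => /negP.
  by rewrite -ltNge => /ltW.
have /negP := bounded n; rewrite -ltNge => /ltW; apply: le_trans.
by rewrite [leRHS]big_ltn// lerDr.
Qed.

Lemma summable_le (a b : nat -> R) (C : R) :
  (forall k, 0 <= a k)%R -> (forall k, 0 <= b k)%R -> (0 <= C)%R ->
  (forall k, (0 < k)%N -> a k <= C * b k)%R ->
  \sum_(1 <= k <oo) (b k)%:E < +oo -> \sum_(1 <= k <oo) (a k)%:E < +oo.
Proof.
move=> a0 b0 C0 ab sumb.
apply: (@le_lt_trans _ _ (\sum_(1 <= k <oo) (C%:E * (b k)%:E))).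
  rewrite eseries_cond [leRHS]eseries_cond.
  apply: lee_nneseries => [k _ _|k /andP[_ k1]]; first by rewrite lee_fin.
  by rewrite -EFinM lee_fin ab.
rewrite nneseriesZl; last by move=> k _; rewrite lee_fin.
by rewrite lte_mul_pinfty.
Qed.

End series.

Section additive_functional.
Context {R : realType} {dT : measure_display} {T : measurableType dT}.
Context {P : probability T R} {d : nat}.
Hypothesis d_ge3 : (3 <= d)%N.
Variable S : nat -> {RV P >-> 'rV[int]_d}.
Hypothesis S_srw : simple_random_walk S.
Variables (nrm : 'rV[int]_d -> nat) (gauge : lattice_gauge nrm).
Variables (f : nat -> R) (f_ge0 : forall k, 0 <= f k).

Let d_gt0 : (0 < d)%N. Proof. lia. Qed.

Let X t : \bar R := (\sum_(1 <= n <oo) (f (nrm (S n t)))%:E)%E.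

Let term_ge0 n t : (0 <= (f (nrm (S n t)))%:E)%E.
Proof. by rewrite lee_fin. Qed.

Lemma measurable_state (g : 'rV[int]_d -> \bar R) n :
  measurable_fun setT (fun t => g (S n t)).
Proof.
move=> _ Y mY; rewrite setTI.
exact: (measurable_trajectory S [:: n] (fun s => Y (g (nth 0 s 0)))).
Qed.

Let XE t : X t = (\sum_(n <oo) (f (nrm (S n.+1 t)))%:E)%E.
Proof.
rewrite /X -(nneseries_addn 1)//.
by apply: eq_eseriesr => n _; rewrite addn1.
Qed.

Lemma measurable_functional : measurable_fun setT X.
Proof.
rewrite (_ : X = fun t => (\sum_(0 <= n <oo | n \in xpredT) (f (nrm (S n.+1 t)))%:E)%E).
  apply: ge0_emeasurable_sum => // n _.
  exact: (measurable_state (fun x => (f (nrm x))%:E)).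
by apply/funext => t; rewrite XE.
Qed.

Lemma measurable_functional_lt c : measurable [set t | (X t < c)%E].
Proof.
rewrite -[X in measurable X]setTI.
have := measurable_functional measurableT (emeasurable_itv `]-oo, c[%E).
by congr (measurable (_ `&` _)); apply/seteqP; split => t /=; rewrite in_itv.
Qed.

Lemma pexp_last N (x : 'rV[int]_d) (g : 'rV[int]_d -> R) :
  pexp N x (fun s => g (last x s)) = iter N avg g x.
Proof. by elim: N x => //= N IH x; apply: eq_avg => y; exact: IH. Qed.

Lemma prob_level n k : P [set t | nrm (S n t) = k] =
  (iter n avg (fun y => (nrm y == k)%:R) 0)%:E.
Proof.
have := path_law0 d_gt0 S_srw (fun s => nrm (last 0 s) == k) n.
rewrite (pexp_last n 0 (fun y => (nrm y == k)%:R)) => <-.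
congr (P _).
suff lastE t : last 0 [seq S i t | i <- iota 1 n] = S n t.
  by apply/seteqP; split => t /=; rewrite lastE => /eqP.
case: n => [|n]; first by rewrite (srw_start S_srw).
by have := iotaD 1 n 1; rewrite addn1 => ->; rewrite map_cat last_cat/= add1n.
Qed.

(** The sum is exchanged into sum_k f k E [L_k], to which the upper bound
    applies; the term k = 0 is finite but has no counterpart in the
    hypothesis. *)
Lemma expectation_finite :
  (\sum_(1 <= k <oo) (k%:R * f k)%:E < +oo)%E -> (\int[P]_t X t < +oo)%E.
Proof.
move=> sumf; have [C C0 upper] := @occ_sphere_le R d d_ge3 nrm gauge.
pose level n k := [set t | nrm (S n.+1 t) = k].
have mlevel n k : measurable (level n k).
  exact: (measurable_trajectory S [:: n.+1] (fun s => nrm (nth 0 s 0) = k)).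
pose a n k : \bar R := ((f k)%:E * P (level n k))%E.
have a0 n k : (0 <= a n k)%E by rewrite mule_ge0 ?lee_fin ?measure_ge0.
have intE n : (\int[P]_t (f (nrm (S n.+1 t)))%:E = \sum_(k <oo) a n k)%E.
  under eq_integral do rewrite -(nneseries_pred1 _ f_ge0).
  have ind k t : (nrm (S n.+1 t) == k)%:R = \1_(level n k) t :> R.
    by rewrite indicE; congr (nat_of_bool _)%:R; apply/eqP/idP; rewrite inE.
  rewrite integral_nneseries//=.
  - apply: eq_eseriesr => k _; rewrite /a.
    under eq_integral do rewrite ind EFinM.
    rewrite ge0_integralZl//= ?lee_fin//.
    + by rewrite integral_indic// setIT.
    + by apply/measurable_EFinP; exact: measurable_indic.
  - move=> k; apply: (measurable_state (fun x => (f k * (nrm x == k)%:R)%:E)).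
  - by move=> k t _; rewrite lee_fin mulr_ge0.
under eq_integral do rewrite XE.
rewrite integral_nneseries//; last first.
  by move=> n; exact: (measurable_state (fun x => (f (nrm x))%:E)).
under eq_eseriesr do rewrite intE.
rewrite nneseries_interchange//.
have level_le k : (\sum_(n <oo) a n k <= (f k * (C * k.+1%:R))%:E)%E.
  apply: nneseries_le_bound => // N.
  rewrite -ge0_sume_distrr// EFinM lee_wpmul2l ?lee_fin//.
  rewrite (eq_bigr (fun n => (iter n.+1 avg (fun y => (nrm y == k)%:R) 0)%:E)); last first.
    by move=> n _; exact: prob_level.
  rewrite sumEFin lee_fin; apply: le_trans (upper k N.+1 0).
  by rewrite /occ big_nat_recl//= lerDr.
apply: (@le_lt_trans _ _ (\sum_(k <oo) (f k * (C * k.+1%:R))%:E)%E).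
  by apply: lee_nneseries => [k _ _|k _]; [exact: nneseries_ge0|exact: level_le].
have b0 k : (0 <= (f k * (C * k.+1%:R))%:E)%E by rewrite lee_fin !mulr_ge0// ltW.
rewrite nneseries_recl// lte_add_pinfty ?ltry//.
apply: (@summable_le _ _ (fun k => k%:R * f k) (2 * C)) sumf => [k|k||k k1].
- by rewrite !mulr_ge0// ltW.
- by rewrite mulr_ge0.
- by rewrite mulr_ge0// ltW.
have k1R : 1 <= k%:R :> R by rewrite ler1n.
have : 0 <= f k * C * (k%:R - 1) by rewrite !mulr_ge0 ?subr_ge0// ltW.
by rewrite -natr1; lra.
Qed.

Lemma finite_almost_surely :
  (\int[P]_t X t < +oo)%E -> P [set t | (X t < +oo)%E] = 1%E.
Proof.
move=> intX; have mF := measurable_functional_lt +oo%E.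
have X0 t : (0 <= X t)%E by apply: nneseries_ge0.
have iX : P.-integrable setT X.
  apply/integrableP; split; first exact: measurable_functional.
  by under eq_integral do rewrite gee0_abs//.
have : P.-negligible (~` [set t | (X t < +oo)%E]).
  apply: negligibleS (integrable_ae measurableT iX) => t /= Xt fin.
  by apply: Xt; rewrite -ge0_fin_numE//; exact: fin.
move=> negl; have : P (~` [set t | (X t < +oo)%E]) = 0%E.
  by apply: measure_negligible => //; exact: measurableC.
rewrite probability_setC// => /eqP; rewrite sube_eq ?add0e//.
  by move=> /eqP.
Qed.

(** By contraposition: if the weighted series diverges, the sum is below M with
    probability 0 for each natural number M. *)
Lemma finite_positive_summable :
  (0 < P [set t | (X t < +oo)%E])%E ->
  (\sum_(1 <= k <oo) (k%:R * f k)%:E < +oo)%E.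
Proof.
move=> Ppos; apply: contrapT => div.
have kf0 k : 0 <= k%:R * f k by rewrite mulr_ge0.
have unb := nneseries_unbounded kf0 div.
have mF := measurable_functional_lt +oo%E.
move: Ppos; apply/negP; rewrite -leNgt.
pose E M := [set t | (X t < M%:R%:E)%E].
have PE M eps : 0 < eps -> exists2 B, measurable B & E M `<=` B /\ (P B <= eps%:E)%E.
  move=> eps0.
  have [N hN] := prob_below_cvg0 d_ge3 gauge f_ge0 unb 0 M%:R eps0.
  exists [set t | (\sum_(y <- [seq S n t | n <- iota 1 N]) f (nrm y) < M%:R)%R].
    exact: (measurable_trajectory S (iota 1 N)
      (fun s => (\sum_(y <- s) f (nrm y) < M%:R)%R)).
  split => [t /=|]; last first.
    by rewrite (path_law0 d_gt0 S_srw (fun s => \sum_(y <- s) f (nrm y) < M%:R)) lee_fin.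
  rewrite /E /= => XM; rewrite -lte_fin; apply: le_lt_trans XM.
  rewrite big_map -sumEFin -[iota 1 N](_ : index_iota 1 N.+1 = _).
    exact: nneseries_lim_ge.
  by rewrite /index_iota subn1.
have : P.-negligible [set t | (X t < +oo)%E].
  apply: (@negligibleS _ _ _ _ (\bigcup_M E M)).
    move=> t /= Xt; have Xfin : X t \is a fin_num.
      by rewrite ge0_fin_numE// nneseries_ge0.
    exists (Num.bound (fine (X t))) => //.
    rewrite /E /= -(fineK Xfin) lte_fin; apply: archi_boundP.
    by rewrite fine_ge0// nneseries_ge0.
  apply: negligible_bigcup => M.
  exists (E M); split => //; first exact: measurable_functional_lt.
  apply/eqP; rewrite eq_le measure_ge0 andbT; apply/lee_addgt0Pr => eps eps0.
  have [B mB [EB PB]] := PE M eps eps0; rewrite add0e; apply: le_trans PB.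
  by apply: le_measure; rewrite ?inE//; exact: measurable_functional_lt.
by move=> /(measure_negligible mF) ->.
Qed.

End additive_functional.

(** * Sizes of spheres and the equivalence *)

Section spheres.
Context {d' : nat}.
Let d := d'.+1.

Definition insert_coord (i0 : 'I_d) (a : int) (y : 'I_d' -> int) : 'rV[int]_d :=
  \row_i oapp y a (unlift i0 i).

Lemma insert_coord_at i0 a y : insert_coord i0 a y ord0 i0 = a.
Proof. by rewrite mxE unlift_none. Qed.

Lemma insert_coord_lift i0 a y j : insert_coord i0 a y ord0 (lift i0 j) = y j.
Proof. by rewrite mxE liftK. Qed.

Lemma insert_coordK i0 (x : 'rV[int]_d) :
  insert_coord i0 (x ord0 i0) (fun j => x ord0 (lift i0 j)) = x.
Proof. by apply/rowP => i; rewrite mxE; case: unliftP => [j|] ->. Qed.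

Variables (nrm : 'rV[int]_d -> nat) (k : nat).
Hypothesis fin : finite_set [set x | nrm x = k].

(** Points of the sphere with d' small nonnegative coordinates y, the remaining
    coordinate t y being adjusted to reach norm k. *)
Lemma sphere_card_ge (m : nat) (t : ('I_d' -> nat) -> nat) :
  (forall y : 'I_d' -> nat, (forall j, y j <= m)%N ->
    nrm (insert_coord ord0 (t y) (fun j => y j)) = k) ->
  (m.+1 ^ d' <= sphere_card nrm k)%N.
Proof.
move=> hk; pose W : finType := {ffun 'I_d' -> 'I_m.+1}.
pose g (w : W) := insert_coord ord0 (t (fun j => w j)) (fun j => (w j : nat)%:Z).
have g_inj : injective g.
  move=> w1 w2 /(congr1 (fun x : 'rV[int]_d => x ord0 (lift ord0 _))) h.
  apply/ffunP => j; have := h j.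
  by rewrite !insert_coord_lift => -[] /val_inj.
have -> : (m.+1 ^ d')%N = size [seq g w | w <- enum {: W}].
  by rewrite size_map -cardE card_ffun !card_ord.
apply: uniq_leq_size; first by rewrite map_inj_uniq// enum_uniq.
move=> x /mapP[w _ ->]; rewrite in_fset_set// inE /=.
by apply: hk => j; rewrite -ltnS.
Qed.

(** A point of the sphere is recovered from the position and the sign of a
    well-chosen coordinate, together with all the other coordinates. *)
Lemma sphere_card_le (t : ('I_d' -> int) -> nat) :
  (forall (x : 'rV[int]_d) i, `|x ord0 i| <= nrm x)%N ->
  (forall x : 'rV[int]_d, nrm x = k -> exists i0,
    `|x ord0 i0|%N = t (fun j => x ord0 (lift i0 j))) ->
  (sphere_card nrm k <= 2 * d * (2 * k).+1 ^ d')%N.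
Proof.
move=> coord hk.
pose W : finType := ('I_d * bool * {ffun 'I_d' -> 'I_(2 * k).+1})%type.
pose shift (y : {ffun 'I_d' -> 'I_(2 * k).+1}) j : int := (y j : nat)%:Z - k%:Z.
pose g (w : W) := insert_coord w.1.1 ((-1) ^+ w.1.2 * (t (shift w.2))%:Z) (shift w.2).
have -> : (2 * d * (2 * k).+1 ^ d')%N = size [seq g w | w <- enum {: W}].
  by rewrite size_map -cardE !card_prod card_bool card_ffun !card_ord (mulnC 2).
apply: uniq_leq_size; first exact: fset_uniq.
move=> x; rewrite in_fset_set// inE /= => xk.
have [i0 xi0] := hk x xk.
have lt j : (`|(x ord0 (lift i0 j) + k%:Z)%R| < (2 * k).+1)%N.
  by have := coord x (lift i0 j); rewrite xk; move: (x ord0 _) => z; lia.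
pose y := [ffun j => Ordinal (lt j)].
apply/mapP; exists (i0, x ord0 i0 < 0, y); first by rewrite mem_enum.
have yE : shift y = fun j => x ord0 (lift i0 j).
  apply/funext => j; rewrite /shift ffunE /=.
  by have := coord x (lift i0 j); rewrite xk; move: (x ord0 _) => z; lia.
by rewrite /g /= yE -xi0 -intEsign insert_coordK.
Qed.

End spheres.

Lemma max_norm_insert d' (i0 : 'I_d'.+1) a (y : 'I_d' -> int) :
  (forall j, `|y j| <= `|a|)%N -> max_norm (insert_coord i0 a y) = `|a|%N.
Proof.
move=> ya; apply/eqP; rewrite eqn_leq; apply/andP; split.
  by apply: max_norm_le => i; rewrite mxE; case: unliftP => [j|] _ /=.
by have := le_max_norm (insert_coord i0 a y) i0; rewrite insert_coord_at.
Qed.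

Lemma l1_norm_insert d' (i0 : 'I_d'.+1) a (y : 'I_d' -> int) :
  l1_norm (insert_coord i0 a y) = (`|a| + \sum_(j < d') `|y j|)%N.
Proof.
rewrite /l1_norm (bigD1_ord i0)//= insert_coord_at; congr (_ + _)%N.
by apply: eq_bigr => j _; rewrite insert_coord_lift.
Qed.

Lemma sphere_card_growth d (nrm : 'rV[int]_d -> nat) k : (0 < d)%N -> (0 < k)%N ->
  nrm = @max_norm d \/ nrm = @l1_norm d ->
  (k ^ d.-1 <= d ^ d.-1 * sphere_card nrm k)%N /\
  (sphere_card nrm k <= 2 * d * 3 ^ d.-1 * k ^ d.-1)%N.
Proof.
case: d nrm => // d' nrm _ k0 nrmE; have fin := finite_sphere k nrmE.
rewrite [d'.+1.-1]/=; split.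
  apply: (@leq_trans (d'.+1 ^ d' * (k %/ d'.+1).+1 ^ d')%N).
    rewrite -expnMn; case: (d') => // n; rewrite leq_exp2r//.
    by rewrite mulnC ltnW// ltn_ceil.
  rewrite leq_mul2l; apply/orP; right.
  have kd : (k %/ d'.+1 <= k)%N by exact: leq_div.
  case: nrmE fin => -> fin.
    apply: (sphere_card_ge fin (t := fun=> k)) => y hy.
    by rewrite max_norm_insert// => j; apply: leq_trans (hy j) kd.
  apply: (sphere_card_ge fin (t := fun y => k - \sum_(j < d') y j)%N) => y hy.
  rewrite l1_norm_insert subnK//.
  apply: (@leq_trans (\sum_(j < d') (k %/ d'.+1))%N); first exact: leq_sum.
  rewrite sum_nat_const card_ord.
  by apply: leq_trans (leq_trunc_div k d'.+1); rewrite mulnC leq_mul2l leqnSn orbT.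
apply: (@leq_trans (2 * d'.+1 * (2 * k).+1 ^ d')%N).
  case: nrmE fin => -> fin.
    apply: (sphere_card_le fin (t := fun=> k)); first exact: le_max_norm.
    by move=> x <-; have [i ->] := max_norm_attained x (ltn0Sn d'); exists i.
  apply: (sphere_card_le fin (t := fun y => k - \sum_(j < d') `|y j|)%N).
    by move=> x i; rewrite /l1_norm (bigD1 i)//= leq_addr.
  move=> x <-; exists ord0.
  by rewrite /l1_norm big_ord_recl addnK.
rewrite -[leqRHS]mulnA leq_mul2l -expnMn; apply/orP; right.
by case: (d') => // n; rewrite leq_exp2r; lia.
Qed.

Lemma sphere_weight (R : realType) d (nrm : 'rV[int]_d -> nat) k :
  (0 < d)%N -> (0 < k)%N -> nrm = @max_norm d \/ nrm = @l1_norm d ->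
  k%:R <= (d ^ d.-1)%:R * (k%:R ^ (2 - d%:Z) * (sphere_card nrm k)%:R) :> R /\
  k%:R ^ (2 - d%:Z) * (sphere_card nrm k)%:R <=
    (2 * d * 3 ^ d.-1)%:R * k%:R :> R.
Proof.
move=> d0 k0 nrmE; have [lo up] := sphere_card_growth d0 k0 nrmE.
have kR : 0 < k%:R :> R by rewrite ltr0n.
have powE : k%:R ^ (2 - d%:Z) = k%:R / k%:R ^+ d.-1 :> R.
  rewrite (_ : 2 - d%:Z = 1 - d.-1%:Z); last by lia.
  by rewrite expfzDr ?gt_eqF// expr1z -exprnN.
rewrite powE; split.
  have := lo; rewrite -(ler_nat R) natrM natrX => lo'.
  have : k%:R * k%:R ^+ d.-1 <= (d ^ d.-1)%:R * (k%:R * (sphere_card nrm k)%:R) :> R.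
    by rewrite mulrCA ler_pM2l.
  by rewrite -ler_pdivlMr ?exprn_gt0// => /le_trans; apply;
    rewrite le_eqVlt; apply/orP; left; apply/eqP; ring.
rewrite mulrAC ler_pdivrMr ?exprn_gt0// [leRHS]mulrAC mulrC ler_pM2r//.
by have := up; rewrite -(ler_nat R) natrM natrX.
Qed.

Theorem corollary1p2 (R : realType) (dT : measure_display)
  (T : measurableType dT) (P : probability T R) (d : nat) (d_ge3 : (3 <= d)%N)
  (S : nat -> {RV P >-> 'rV[int]_d}) (S_srw : simple_random_walk S)
  (nrm : 'rV[int]_d -> nat) (nrmE : nrm = @max_norm d \/ nrm = @l1_norm d)
  (f : nat -> R) (f_ge0 : forall k, 0 <= f k) :
  [<-> (0 < P [set t | \sum_(1 <= n <oo) (f (nrm (S n t)))%:E < +oo])%E;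
       P [set t | \sum_(1 <= n <oo) (f (nrm (S n t)))%:E < +oo]%E = 1%E;
       (\int[P]_t (\sum_(1 <= n <oo) (f (nrm (S n t)))%:E) < +oo)%E;
       (\sum_(1 <= k <oo)
          ((k%:R : R) ^ (2 - d%:Z) * (sphere_card nrm k)%:R * f k)%:E < +oo)%E;
       (\sum_(1 <= k <oo) (k%:R * f k)%:E < +oo)%E].
Proof.
have d_gt0 : (0 < d)%N by apply: leq_trans d_ge3.
have gauge : lattice_gauge nrm.
  by case: nrmE => ->; [exact: max_norm_gauge|exact: l1_norm_gauge].
have V_of_I := finite_positive_summable d_ge3 S_srw gauge f_ge0.
have III_of_V := expectation_finite d_ge3 S_srw gauge f_ge0.
have II_of_III := @finite_almost_surely _ _ _ P _ S nrm f f_ge0.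
have weight_ge0 k : 0 <= (k%:R : R) ^ (2 - d%:Z) * (sphere_card nrm k)%:R * f k.
  by rewrite !mulr_ge0// exprz_ge0.
have kf_ge0 k : 0 <= k%:R * f k by rewrite mulr_ge0.
tfae.
- by move=> /V_of_I /III_of_V /II_of_III.
- by move=> II; apply/III_of_V/V_of_I; rewrite II lte01.
- move=> /II_of_III II; have V : (\sum_(1 <= k <oo) (k%:R * f k)%:E < +oo)%E.
    by apply: V_of_I; rewrite II lte01.
  apply: (summable_le (C := (2 * d * 3 ^ d.-1)%:R)) V => // k k0.
  by rewrite mulrA ler_wpM2r//; case: (sphere_weight R d_gt0 k0 nrmE).
- apply: (summable_le (C := (d ^ d.-1)%:R)) => // k k0.
  by rewrite mulrA ler_wpM2r//; case: (sphere_weight R d_gt0 k0 nrmE).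
- by move=> /III_of_V /II_of_III ->; rewrite lte01.
Qed.
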